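(* Let $d\ge1$, let $A\in\mathbb{R}^{d\times d}$ be symmetric positive definite, let $c>0$, and let $\varphi(x)=c\exp\bigl(-\tfrac12x^{\top}Ax\bigr)$ for $x\in\mathbb{R}^d$. Then $\{x^\alpha\varphi(x):\alpha\in\mathbb{N}_0^d\}$ is total in $\mathcal{S}(\mathbb{R}^d)$. Consequently, for such a fixed kernel, the weak moment array $\{\langle T,x^\alpha\varphi\rangle\}_{\alpha\in\mathbb{N}_0^d}$ uniquely determines $T\in\mathcal{S}'(\mathbb{R}^d)$: if $T_1,T_2\in\mathcal{S}'(\mathbb{R}^d)$ satisfy $\langle T_1,x^\alpha\varphi\rangle=\langle T_2,x^\alpha\varphi\rangle$ for all $\alpha\in\mathbb{N}_0^d$, then $T_1=T_2$.
   Context: $\mathcal{S}(\mathbb{R}^d)$ is the Schwartz space with its usual Fréchet topology and $\mathcal{S}'(\mathbb{R}^d)$ its dual. For a multi-index $\alpha\in\mathbb{N}_0^d$, $x^\alpha=x_1^{\alpha_1}\cdots x_d^{\alpha_d}$. A family is total if its linear span is dense. *)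

(* Defs.v *)
From HB Require Import structures.
From mathcomp Require Import all_boot all_order all_algebra.
From mathcomp Require Import all_classical all_reals all_analysis.
From mathcomp Require Import complex.

Set Implicit Arguments.
Unset Strict Implicit.
Unset Printing Implicit Defensive.
Import Order.TTheory GRing.Theory Num.Theory.
Import numFieldNormedType.Exports.
Local Open Scope classical_set_scope.
Local Open Scope ring_scope.

Notation multiindex d := {ffun 'I_d -> nat}.

Section calculus.
Context {R : realType} {d : nat}.
Implicit Types (g h : 'rV[R]_d -> R) (f : 'rV[R]_d -> R[i]^o).
Implicit Types (s : seq 'I_d) (alpha beta : multiindex d).

Definition monomial alpha (x : 'rV[R]_d) : R := \prod_i x 0 i ^+ alpha i.

(* The partial derivatives in the directions listed in [s], applied from the
   last one to the first one. *)
Definition ipartial s g : 'rV[R]_d -> R :=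
  foldr (fun i h x => 'D_(delta_mx 0 i) h x) g s.

Definition smooth g := forall s,
  continuous (ipartial s g) /\
  forall i x, derivable (ipartial s g) x (delta_mx 0 i).

Definition mderiv beta :=
  ipartial (flatten [seq nseq (beta i) i | i <- enum 'I_d]).

(* A complex-valued function is differentiated through its real and imaginary
   parts, so that the only scalars involved in the derivatives are real. *)
Definition csmooth f :=
  smooth (fun x => complex.Re (f x)) /\ smooth (fun x => complex.Im (f x)).

Definition cmderiv beta f (x : 'rV[R]_d) : R[i] :=
  (mderiv beta (fun x => complex.Re (f x)) x +i*
   mderiv beta (fun x => complex.Im (f x)) x)%C.

(* [normc] is the modulus as an element of [R]; the norm [`|z|] lives in
   [R[i]]. *)
Definition weighted alpha beta f (x : 'rV[R]_d) : R :=
  ComplexField.Normc.normc ((monomial alpha x)%:C%C * cmderiv beta f x).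

Definition seminorm alpha beta f : R := sup (range (weighted alpha beta f)).

Definition is_schwartz : set ('rV[R]_d -> R[i]^o) := [set f | csmooth f /\
  forall alpha beta, has_ubound (range (weighted alpha beta f))].

Let lin (a b : R) g h := fun x => a * g x + b * h x.

Lemma ipartial_lin a b g h s : smooth g -> smooth h ->
  ipartial s (lin a b g h) = lin a b (ipartial s g) (ipartial s h).
Proof.
move=> sg sh; elim: s => [//|i s IH] /=; apply/funext => x.
rewrite {}IH (_ : lin _ _ _ _ = a \*: (ipartial s g : _ -> R^o) +
  b \*: (ipartial s h : _ -> R^o))//.
have dg := (sg s).2 i x; have dh := (sh s).2 i x.
by rewrite (deriveD (derivableZ dg) (derivableZ dh)) (deriveZ a dg) (deriveZ b dh).
Qed.

Lemma smooth_lin a b g h : smooth g -> smooth h -> smooth (lin a b g h).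
Proof.
move=> sg sh s; rewrite ipartial_lin//; split=> [x|i x].
  exact: (continuousD (continuousM (@cst_continuous _ _ a x) ((sg s).1 x))
    (continuousM (@cst_continuous _ _ b x) ((sh s).1 x))).
rewrite (_ : lin _ _ _ _ = a \*: (ipartial s g : _ -> R^o) +
  b \*: (ipartial s h : _ -> R^o))//.
have dg := (sg s).2 i x; have dh := (sh s).2 i x.
by apply: derivableD; exact: derivableZ.
Qed.

Let Re_lin (c : R[i]) f1 f2 : (fun x => complex.Re ((c *: f1 + f2) x)) =
  lin 1 1 (lin (complex.Re c) (- complex.Im c) (fun x => complex.Re (f1 x))
    (fun x => complex.Im (f1 x))) (fun x => complex.Re (f2 x)).
Proof.
apply/funext => x; rewrite /lin !mul1r mulNr -[(_ + _) x]/(c * f1 x + f2 x).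
by case: c => c1 c2; case: (f1 x) => ? ?; case: (f2 x) => ? ?.
Qed.

Let Im_lin (c : R[i]) f1 f2 : (fun x => complex.Im ((c *: f1 + f2) x)) =
  lin 1 1 (lin (complex.Im c) (complex.Re c) (fun x => complex.Re (f1 x))
    (fun x => complex.Im (f1 x))) (fun x => complex.Im (f2 x)).
Proof.
apply/funext => x; rewrite /lin !mul1r -[(_ + _) x]/(c * f1 x + f2 x).
case: c => c1 c2; case: (f1 x) => ? ?; case: (f2 x) => ? ? /=.
by congr (_ + _); rewrite addrC.
Qed.

Lemma csmooth_lin (c : R[i]) f1 f2 :
  csmooth f1 -> csmooth f2 -> csmooth (c *: f1 + f2).
Proof.
move=> [r1 i1] [r2 i2]; split.
  by rewrite Re_lin; exact: smooth_lin (smooth_lin _ _ r1 i1) r2.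
by rewrite Im_lin; exact: smooth_lin (smooth_lin _ _ r1 i1) i2.
Qed.

Lemma cmderiv_lin beta (c : R[i]) f1 f2 x : csmooth f1 -> csmooth f2 ->
  cmderiv beta (c *: f1 + f2) x = c * cmderiv beta f1 x + cmderiv beta f2 x.
Proof.
move=> [r1 i1] [r2 i2]; rewrite /cmderiv Re_lin Im_lin /mderiv.
rewrite !(ipartial_lin _ _ _ (smooth_lin _ _ r1 i1))//.
rewrite !(ipartial_lin _ _ _ r1 i1).
rewrite /lin !mul1r; case: c => c1 c2; apply/eqP; rewrite eq_complex/=.
by rewrite mulNr eqxx/= [X in X + _ == _]addrC.
Qed.

Lemma weighted_lin alpha beta (c : R[i]) f1 f2 x : csmooth f1 -> csmooth f2 ->
  weighted alpha beta (c *: f1 + f2) x <=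
  ComplexField.Normc.normc c * weighted alpha beta f1 x
  + weighted alpha beta f2 x.
Proof.
move=> s1 s2; rewrite /weighted cmderiv_lin// mulrDr mulrCA.
by rewrite -ComplexField.Normc.normcM; exact: le_normcD.
Qed.

Lemma weighted_ge0 alpha beta f x : 0 <= weighted alpha beta f x.
Proof. by rewrite /weighted; case: (_ * _) => ? ?; exact: sqrtr_ge0. Qed.

Lemma weighted_le alpha beta f x : is_schwartz f ->
  weighted alpha beta f x <= seminorm alpha beta f.
Proof. by move=> [_ /(_ alpha beta) ub]; apply: ub_le_sup => //; exists x. Qed.

Lemma weighted_lin_le alpha beta (c : R[i]) f1 f2 x :
  is_schwartz f1 -> is_schwartz f2 ->
  weighted alpha beta (c *: f1 + f2) x <=
  ComplexField.Normc.normc c * seminorm alpha beta f1 + seminorm alpha beta f2.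
Proof.
move=> S1 S2; apply: (le_trans (weighted_lin _ _ _ _ S1.1 S2.1)).
apply: lerD; last exact: weighted_le.
by apply: ler_wpM2l; [case: (c) => ? ?; exact: sqrtr_ge0|exact: weighted_le].
Qed.

Lemma seminorm_lin alpha beta (c : R[i]) f1 f2 :
  is_schwartz f1 -> is_schwartz f2 ->
  seminorm alpha beta (c *: f1 + f2) <=
  ComplexField.Normc.normc c * seminorm alpha beta f1 + seminorm alpha beta f2.
Proof.
move=> S1 S2; apply: ge_sup; first by exists (weighted alpha beta (c *: f1 + f2) 0), 0.
by move=> _ [x _ <-]; exact: weighted_lin_le.
Qed.

Lemma seminorm_ge0 alpha beta f : is_schwartz f -> 0 <= seminorm alpha beta f.
Proof.
by move=> Sf; exact: le_trans (weighted_ge0 _ _ _ 0) (weighted_le _ _ 0 Sf).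
Qed.

Lemma ipartial0 s : ipartial s (fun=> 0) = fun=> 0.
Proof.
elim: s => [//|i s IH] /=; apply/funext => x; rewrite IH.
exact: (@derive_cst _ _ R^o).
Qed.

Lemma weighted0 alpha beta x : weighted alpha beta (0 : _ -> R[i]^o) x = 0.
Proof.
rewrite /weighted /cmderiv /mderiv !ipartial0.
by rewrite (_ : (0 +i* 0)%C = 0)// mulr0 ComplexField.Normc.normc0.
Qed.

Lemma is_schwartz0 : is_schwartz (0 : 'rV[R]_d -> R[i]^o).
Proof.
have sm : smooth (fun=> 0 : R).
  by move=> s; rewrite ipartial0; split=> *; [exact: cst_continuous|exact: derivable_cst].
split; first by split.
by move=> alpha beta; exists 0 => _ [x _ <-]; rewrite weighted0.
Qed.

Lemma is_schwartz_lin (c : R[i]) f1 f2 :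
  is_schwartz f1 -> is_schwartz f2 -> is_schwartz (c *: f1 + f2).
Proof.
move=> S1 S2; split; first by apply: csmooth_lin; [exact: S1.1|exact: S2.1].
by move=> alpha beta; eexists => _ [x _ <-]; exact: weighted_lin_le.
Qed.

End calculus.

Definition schwartz_pred (R : realType) d : {pred 'rV[R]_d -> R[i]^o} :=
  fun f => f \in is_schwartz.

Record schwartz (R : realType) (d : nat) := Schwartz {
  schwartz_fun :> 'rV[R]_d -> R[i]^o ;
  schwartz_funP : schwartz_fun \in @schwartz_pred R d }.

HB.instance Definition _ (R : realType) d := [isSub for @schwartz_fun R d].
HB.instance Definition _ (R : realType) d := [Choice of schwartz R d by <:].

Section schwartz_lmodule.
Context (R : realType) (d : nat).

Fact schwartz_submod_closed : submod_closed (@schwartz_pred R d).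
Proof.
split=> [|c f g]; first by apply/mem_set; exact: is_schwartz0.
by move=> /set_mem Sf /set_mem Sg; apply/mem_set; exact: is_schwartz_lin.
Qed.

HB.instance Definition _ :=
  GRing.isSubmodClosed.Build R[i] ('rV[R]_d -> R[i]^o) (@schwartz_pred R d)
    schwartz_submod_closed.
HB.instance Definition _ :=
  [SubChoice_isSubLmodule of schwartz R d by <:].

End schwartz_lmodule.

Fact affine_combinationB (K : pzRingType) (V : lmodType K) (z : K) (f g h : V) :
  z *: g + (1 - z) *: h - f = z *: (g - f) + (1 - z) *: (h - f).
Proof.
rewrite !scalerBr addrACA -opprD -[in RHS]scalerDl.
by rewrite [z + _]addrC subrK scale1r.
Qed.

Section schwartz_topology.
Context (R : realType) (d : nat).
Implicit Types (f g h : schwartz R d).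
Implicit Types (L : seq (multiindex d * multiindex d)) (e : R).
Local Notation normc := ComplexField.Normc.normc.

(* The Frechet topology is the one generated by all the seminorms
   sup_x |x^alpha (D^beta f)(x)|: basic neighbourhoods constrain finitely many
   of them. *)
Definition schwartz_norm (ab : multiindex d * multiindex d) f : R :=
  seminorm ab.1 ab.2 f.

Definition schwartz_ball f L e : set (schwartz R d) :=
  [set g | forall ab, ab \in L -> schwartz_norm ab (g - f) < e].

Definition schwartz_nbhs f : set_system (schwartz R d) :=
  [set U | exists L e, 0 < e /\ schwartz_ball f L e `<=` U].

Let is_schwartz_fun f : is_schwartz f.
Proof. exact: set_mem (schwartz_funP f). Qed.

Lemma schwartz_norm_lin ab (c : R[i]) f g :
  schwartz_norm ab (c *: f + g) <=
  normc c * schwartz_norm ab f + schwartz_norm ab g.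
Proof.
exact: (seminorm_lin _ _ _ (is_schwartz_fun f) (is_schwartz_fun g)).
Qed.

Lemma schwartz_norm_ge0 ab f : 0 <= schwartz_norm ab f.
Proof. exact: seminorm_ge0 (is_schwartz_fun f). Qed.

Lemma schwartz_normD ab f g :
  schwartz_norm ab (f + g) <= schwartz_norm ab f + schwartz_norm ab g.
Proof.
have := schwartz_norm_lin ab 1 f g.
by rewrite scale1r ComplexField.Normc.normc1 mul1r.
Qed.

Lemma schwartz_norm0 ab : schwartz_norm ab 0 = 0.
Proof.
apply/eqP; rewrite eq_le schwartz_norm_ge0 andbT.
apply: ge_sup; first by exists (weighted ab.1 ab.2 (0 : schwartz R d) 0), 0.
by move=> _ [x _ <-]; rewrite weighted0.
Qed.

Lemma schwartz_normZ ab (c : R[i]) f :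
  schwartz_norm ab (c *: f) <= normc c * schwartz_norm ab f.
Proof. by have := schwartz_norm_lin ab c f 0; rewrite schwartz_norm0 !addr0. Qed.

Lemma schwartz_ball_center f L e : 0 < e -> schwartz_ball f L e f.
Proof. by move=> e0 ab _; rewrite subrr schwartz_norm0. Qed.

Let schwartz_nbhs_filter f : ProperFilter (schwartz_nbhs f).
Proof.
split; first by move=> [L [e [e0 /(_ f)]]]; apply; exact: schwartz_ball_center.
split; first by exists [::], 1.
- move=> P Q [L [e [e0 LP]]] [M [e' [e'0 MQ]]].
  exists (L ++ M), (Num.min e e'); split; first by rewrite lt_min e0.
  move=> g Hg; split; [apply: LP|apply: MQ] => ab abL; have := Hg ab;
  by rewrite mem_cat abL ?orbT lt_min => /(_ isT)/andP[].
- by move=> P Q PQ [L [e [e0 LP]]]; exists L, e; split=> //; exact: subset_trans PQ.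
Qed.

Let schwartz_nbhs_singleton f (A : set (schwartz R d)) : schwartz_nbhs f A -> A f.
Proof. by move=> [L [e [e0]]]; apply; exact: schwartz_ball_center. Qed.

Lemma schwartz_nbhs_ball f L e g :
  schwartz_ball f L e g -> 0 < e -> schwartz_nbhs g (schwartz_ball f L e).
Proof.
move=> fg e0.
pose m := \big[Order.max/0]_(ab <- L) schwartz_norm ab (g - f).
have me : m < e.
  by rewrite /m big_seq; elim/big_ind : _ => // x y xe ye; rewrite gt_max xe.
exists L, (e - m); split; first by rewrite subr_gt0.
move=> h gh ab abL; rewrite -(subrK g h) -addrA.
apply: le_lt_trans (schwartz_normD _ _ _) _.
rewrite -(subrK m e); apply: ltr_leD; first exact: gh.
by apply: le_bigmax_seq abL isT.
Qed.

Let schwartz_nbhs_nbhs f (A : set (schwartz R d)) :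
  schwartz_nbhs f A -> schwartz_nbhs f (schwartz_nbhs^~ A).
Proof.
move=> [L [e [e0 LA]]]; exists L, e; split=> // g fg.
have [M [e' [e'0 MA]]] := schwartz_nbhs_ball fg e0.
by exists M, e'; split=> //; exact: subset_trans LA.
Qed.

HB.instance Definition _ := hasNbhs.Build (schwartz R d) schwartz_nbhs.
HB.instance Definition _ := Nbhs_isNbhsTopological.Build (schwartz R d)
  schwartz_nbhs_filter schwartz_nbhs_singleton schwartz_nbhs_nbhs.

Let schwartz_add_continuous :
  continuous (fun x : schwartz R d * schwartz R d => x.1 + x.2).
Proof.
move=> [f g] U [L [e [e0 LU]]].
exists (schwartz_ball f L (e / 2), schwartz_ball g L (e / 2)).
  by split; exists L, (e / 2); split; rewrite ?divr_gt0.
move=> [f' g'] [/= ff' gg']; apply: LU => ab abL /=.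
rewrite opprD addrACA [ltRHS]splitr.
apply: le_lt_trans (schwartz_normD _ _ _) _.
by apply: ltrD; [exact: ff'|exact: gg'].
Qed.

Let schwartz_scale_continuous :
  continuous (fun z : R[i]^o * schwartz R d => z.1 *: z.2).
Proof.
move=> [c f] U [L [e [e0 LU]]].
pose m := \big[Order.max/0]_(ab <- L) schwartz_norm ab f.
have m0 : 0 <= m by exact: bigmax_ge_id.
have normc_ge0 (z : R[i]) : 0 <= normc z by case: z => ? ?; exact: sqrtr_ge0.
pose r := Num.min 1 (e / 2 / (m + 1)).
have m1 : 0 < m + 1 by rewrite ltr_wpDl.
have r0 : 0 < r by rewrite lt_min ltr01 !divr_gt0.
have c1 : 0 < normc c + 1 by rewrite ltr_wpDl.
exists ([set c' : R[i]^o | normc (c' - c) < r],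
        schwartz_ball f L (e / 2 / (normc c + 1))).
  split; last by exists L, (e / 2 / (normc c + 1)); split; rewrite ?divr_gt0.
  apply/nbhs_ballP; exists (r%:C)%C; first by rewrite /= ltcR.
  by move=> c'; rewrite -ball_normE/= distrC -[`|_|]/((normc _)%:C)%C ltcR.
move=> [c' f'] [/= cc' ff']; apply: LU => ab abL /=.
rewrite (_ : c' *: f' - c *: f = c' *: (f' - f) + (c' - c) *: f); last first.
  by rewrite scalerBr scalerBl addrA subrK.
apply: le_lt_trans (schwartz_normD _ _ _) _.
rewrite [ltRHS]splitr; apply: ltr_leD.
  apply: le_lt_trans (schwartz_normZ _ _ _) _.
  apply: (@le_lt_trans _ _ ((normc c + 1) * schwartz_norm ab (f' - f))).
    apply: ler_wpM2r; first exact: schwartz_norm_ge0.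
    rewrite -(subrK c c') addrC; apply: le_trans (le_normcD _ _) _.
    by rewrite lerD2l (le_trans (ltW cc'))// ge_min lexx.
  by rewrite mulrC -ltr_pdivlMr//; exact: ff'.
apply: le_trans (schwartz_normZ _ _ _) _.
apply: (@le_trans _ _ (e / 2 / (m + 1) * (m + 1))); last by rewrite divfK ?gt_eqF.
apply: ler_pM => //; first exact: schwartz_norm_ge0.
  by rewrite (le_trans (ltW cc'))// ge_min lexx orbT.
by rewrite (@le_trans _ _ m) ?lerDl//; exact: le_bigmax_seq abL isT.
Qed.

Lemma schwartz_ball_convex f L e (t : R) g h : 0 <= t -> t <= 1 ->
  schwartz_ball f L e g -> schwartz_ball f L e h ->
  schwartz_ball f L e ((t%:C)%C *: g + (1 - (t%:C)%C) *: h).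
Proof.
move=> t0 t1 fg fh ab abL; rewrite affine_combinationB.
have nt (u : R) : 0 <= u -> normc (u%:C)%C = u.
  by move=> u0; rewrite /= expr0n addr0 sqrtr_sqr ger0_norm.
have tE : 1 - (t%:C)%C = ((1 - t)%:C)%C :> R[i].
  by rewrite [RHS]rmorphB rmorph1.
apply: le_lt_trans (schwartz_normD _ _ _) _.
apply: le_lt_trans (lerD (schwartz_normZ _ _ _) (schwartz_normZ _ _ _)) _.
rewrite tE (nt _ t0) nt ?subr_ge0//.
move: (fg _ abL) (fh _ abL).
move: (schwartz_norm ab (g - f)) (schwartz_norm ab (h - f)) => p q pe qe.
have pm : p <= Num.max p q by rewrite le_max lexx.
have qm : q <= Num.max p q by rewrite le_max lexx orbT.
have me : Num.max p q < e by rewrite gt_max pe.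
apply: le_lt_trans me.
have <- : t * Num.max p q + (1 - t) * Num.max p q = Num.max p q.
  by rewrite -mulrDl subrKC mul1r.
by apply: lerD; apply: ler_wpM2l => //; rewrite subr_ge0.
Qed.

Let schwartz_locally_convex : exists2 B : set_system (schwartz R d),
  (forall b, b \in B -> convex_set b) & basis B.
Proof.
exists [set U | exists f L e, 0 < e /\ U = schwartz_ball f L e]; last first.
  split=> [_ [f [L [e [e0 ->]]]]|f U [L [e [e0 LU]]]].
    by rewrite openE => g fg; exact: schwartz_nbhs_ball.
  exists (schwartz_ball f L e) => //.
  by split; [exists f, L, e|exact: schwartz_ball_center].
move=> _ /set_mem[f [L [e [e0 ->]]]] g h l /set_mem fg /set_mem fh.
have [t [t0 t1 lE]] : exists t : R, [/\ 0 <= t, t <= 1 & l%:num = (t%:C)%C].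
  have := ge0 l; have := le1 l; case: (l%:num) => t u.
  rewrite !lecE/= => /(_ isT)/andP[/eqP <- t1] /(_ isT)/andP[_ t0].
  by exists t.
apply/mem_set; have := schwartz_ball_convex t0 t1 fg fh.
by rewrite -lE.
Qed.

HB.instance Definition _ := PreTopologicalLmod_isTvs.Build R[i] (schwartz R d)
  schwartz_add_continuous schwartz_scale_continuous schwartz_locally_convex.
HB.instance Definition _ := PreTopologicalNmodule_isTopologicalNmodule.Build
  (schwartz R d) schwartz_add_continuous.
HB.instance Definition _ := TopologicalNmodule_isTopologicalLmodule.Build
  R[i] (schwartz R d) schwartz_scale_continuous.
HB.instance Definition _ := Uniform_isTvs.Build R[i] (schwartz R d)
  schwartz_locally_convex.

End schwartz_topology.

Record tempered (R : realType) (d : nat) := Tempered {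
  tempered_fun :> {linear schwartz R d -> R[i]^o} ;
  temperedP : continuous tempered_fun }.

Section total_set.
Context (K : numFieldType) (E : tvsType K).

Definition linear_span (X : set E) : set E :=
  [set v | exists n (a : 'I_n -> K) (u : 'I_n -> E),
    (forall i, X (u i)) /\ v = \sum_(i < n) a i *: u i].

Definition total_set (X : set E) := dense (linear_span X).

End total_set.

(* Points of R^d are row vectors, so x^T A x is written [x *m A *m x^T]. *)
Section gaussian.
Context (R : realType) (d : nat).
Implicit Types (A : 'M[R]_d) (x : 'rV[R]_d).

Definition posdef A := forall x, x != 0 -> 0 < (x *m A *m x^T) 0 0.

Definition gaussian A (c : R) x : R :=
  c * expR (- (1 / 2) * (x *m A *m x^T) 0 0).

End gaussian.

(* Main.v *)
(* Call a family of real functions bounded when every Schwartz seminorm is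
   bounded on it.  By Landau's inequality |g'| <= 2 sup|g| / h + h sup|g''|, a
   bounded family that converges uniformly converges in the Schwartz topology.
   Each step below relies on this; M is the closure of {polynomial * phi}.
   1. If p e^{-Q} is in M for all polynomials p and |q| <= Q / 4 + const, then
      the products of p e^{-Q} with the Taylor polynomials of e^q form a bounded
      family, so that p e^{q - Q} is in M.  Moving from Q = x^T A x / 2 to
      Q = t^2 |x - y|^2 along a segment in small steps, M contains all
      translates of all round Gaussians.
   2. The average of the translates f(x - y_k), with weights proportional to
      e^{-t^2 |y_k|^2} over the nodes y_k of a grid of mesh 1 / (n t), commutes
      with derivatives; hence these averages are bounded and converge to f as
      t grows, uniformly in n.
   3. For fixed t, exchanging the roles of f and of the Gaussian gives a
      combination of translated Gaussians, which lies in M.  The two sums agree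
      on the grid up to boundary terms, so their difference tends to 0 as n
      grows. *)
Require Import Defs.
From mathcomp Require Import all_boot all_order all_algebra.
From mathcomp Require Import all_classical all_reals all_analysis.
From mathcomp Require Import complex.
From mathcomp Require Import ring lra zify.

Set Implicit Arguments.
Unset Strict Implicit.
Unset Printing Implicit Defensive.
Import Order.TTheory GRing.Theory Num.Theory.
Import numFieldNormedType.Exports.
Local Open Scope classical_set_scope.
Local Open Scope ring_scope.

(** * Directional derivatives and iterated partial derivatives *)

Section directional_derivatives.
Context {R : realType} {d : nat}.
Local Notation E := 'rV[R]_d.
Local Notation dir i := (delta_mx 0 i : 'rV[R]_d).
Implicit Types (g h : E -> R) (x y v : E).

(** The two difference quotients are the same function of the increment. Directional derivatives
    thereby inherit the one-variable chain rule and mean value theorem. *)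
Lemma is_derive_line g x v (t df : R) :
  is_derive (t *: v + x) v g df <->
  is_derive t (1 : R) (fun u : R => g (u *: v + x)) df.
Proof.
pose k (u : R) : R := g (u *: v + x).
have E1 : (fun h : R => h^-1 *: ((g \o shift (t *: v + x)) (h *: v)
     - g (t *: v + x) : R^o)) =
  (fun h : R => h^-1 *: ((k \o shift t) (h *: (1 : R^o)) - k t : R^o)).
  by apply/funext => h; rewrite /k /= addrA -scalerDl [h *: 1]mulr1.
split=> -[ex dv].
  split; first by rewrite /derivable -E1.
  by rewrite /derive -E1.
split; first by rewrite /derivable E1.
by rewrite /derive E1.
Qed.

Lemma is_derive_at_line g x v (df : R) :
  is_derive x v g df <-> is_derive (0 : R) (1 : R) (fun u : R => g (u *: v + x)) df.
Proof. by rewrite -is_derive_line scale0r add0r. Qed.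

Lemma is_derive_translate g x y v (df : R) :
  is_derive (x - y) v g df -> is_derive x v (fun z => g (z - y)) df.
Proof.
move=> /is_derive_at_line H; apply/is_derive_at_line.
by under eq_fun do rewrite -addrA.
Qed.

Lemma is_derive_coord x v i : is_derive x v (fun z : E => z 0 i) (v 0 i).
Proof.
apply/is_derive_at_line.
have -> : (fun u : R => (u *: v + x) 0 i) = ( *:%R^~ (v 0 i) : R -> R^o) + cst (x 0 i).
  by apply/funext => u; rewrite !mxE.
by apply: is_derive_eq; rewrite addr0 scaler0 add0r [LHS]mulr1.
Qed.

Lemma is_derive_comp_real (F : R -> R) g x v (dF dg : R) :
  is_derive (g x) (1 : R) F dF -> is_derive x v g dg ->
  is_derive x v (F \o g) (dF * dg).
Proof.
move=> HF /is_derive_at_line Hg; apply/is_derive_at_line.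
by apply: is_derive1_comp; rewrite scale0r add0r.
Qed.

(* Landau: a Taylor step of length [a] bounds a first derivative by the
   function and its second derivative. *)
Lemma landau_step g dg ddg x v (a D C : R) : 0 < a ->
  (forall y, is_derive y v g (dg y)) -> (forall y, is_derive y v dg (ddg y)) ->
  (forall y, `|g y| <= D) -> (forall y, `|ddg y| <= C) ->
  `|dg x| <= 2 * D / a + a * C.
Proof.
move=> a0 Hg Hdg gD ddgC.
have cont (k dk : E -> R) b : (forall y, is_derive y v k (dk y)) ->
    {within `[0, b], continuous (fun u : R => k (u *: v + x))}.
  move=> Hk; apply/continuous_subspaceT => u; apply/differentiable_continuous.
  apply/derivable1_diffP; exact: (@ex_derive _ _ _ _ _ _ _ ((is_derive_line k x v u _).1 (Hk _))).
have [c1 c1a E1] := @MVT _ (fun u : R => g (u *: v + x))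
  (fun u => dg (u *: v + x)) 0 a a0 (fun u _ => (is_derive_line g x v u _).1 (Hg _))
  (cont _ _ _ Hg).
move: c1a; rewrite in_itv /= => /andP[c10 c1a].
have [c2 _ E2] := @MVT _ (fun u : R => dg (u *: v + x))
  (fun u => ddg (u *: v + x)) 0 c1 c10 (fun u _ => (is_derive_line dg x v u _).1 (Hdg _))
  (cont _ _ _ Hdg).
move: E1 E2; rewrite !scale0r !add0r !subr0 => E1 E2.
(* Two mean value steps: at [c1] the derivative equals the difference quotient of [g] over a step of
   length [a], and [c2] pays for going back from [c1] to [x]. *)
have -> : dg x = dg (c1 *: v + x) - ddg (c2 *: v + x) * c1 by rewrite -E2; ring.
apply: le_trans (ler_normB _ _) _; apply: lerD; last first.
  rewrite normrM mulrC (ger0_norm (ltW c10)).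
  by apply: ler_pM => //; exact: ltW.
rewrite ler_pdivlMr// -[X in _ * X <= _](gtr0_norm a0) -normrM -E1.
apply: le_trans (ler_normB _ _) _.
by rewrite mulr_natl mulr2n lerD.
Qed.

(** The path from [x] to [x + y] runs along the axes, one coordinate at a time, with the mean value
    theorem on each segment; hence the l1 norm of [y]. *)
Lemma lipschitz_coord g (dg : 'I_d -> E -> R) (C : R) :
  (forall i y, is_derive y (dir i) g (dg i y)) ->
  (forall i y, `|dg i y| <= C) ->
  forall x y, `|g (x + y) - g x| <= C * \sum_i `|y 0 i|.
Proof.
move=> Hg HC x y.
have step i t z : `|g (t *: dir i + z) - g z| <= C * `|t|.
  have C0 : 0 <= C by exact: le_trans (HC i 0).
  have cont a b : {within `[a, b], continuous (fun u : R => g (u *: dir i + z))}.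
    apply/continuous_subspaceT => u; apply/differentiable_continuous.
    apply/derivable1_diffP.
    exact: (@ex_derive _ _ _ _ _ _ _ ((is_derive_line g z (dir i) u _).1 (Hg _ _))).
  have mvt a b : a < b -> `|g (b *: dir i + z) - g (a *: dir i + z)| <= C * (b - a).
    move=> ab.
    have [c _ ->] := @MVT _ (fun u : R => g (u *: dir i + z))
      (fun u => dg i (u *: dir i + z)) a b ab
      (fun u _ => (is_derive_line g z _ u _).1 (Hg _ _)) (cont _ _).
    rewrite normrM (gtr0_norm (_ : 0 < b - a)) ?subr_gt0//.
    by apply: ler_wpM2r; [rewrite subr_ge0 ltW|exact: HC].
  have [t0|t0|->] := ltrgtP t 0.
  - have := mvt _ _ t0; rewrite scale0r add0r sub0r distrC.
    by rewrite (ltr0_norm t0).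
  - have := mvt _ _ t0; rewrite scale0r add0r subr0.
    by rewrite (gtr0_norm t0).
  - by rewrite scale0r add0r subrr !normr0 mulr0.
have sumE : y = \sum_i y 0 i *: dir i.
  by rewrite {1}(row_sum_delta y).
rewrite {1}sumE; elim: (index_enum _) => [|i s IH].
  by rewrite !big_nil addr0 subrr normr0 mulr0.
rewrite !big_cons mulrDr.
have -> : x + (y 0 i *: dir i + \sum_(j <- s) y 0 j *: dir j) =
   y 0 i *: dir i + (x + \sum_(j <- s) y 0 j *: dir j) by rewrite addrCA.
set z := x + _ in IH *.
have -> : g (y 0 i *: dir i + z) - g x =
  (g (y 0 i *: dir i + z) - g z) + (g z - g x) by ring.
by apply: le_trans (ler_normD _ _) _; apply: lerD.
Qed.

Lemma ipartial_translate s g y :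
  ipartial s (fun x => g (x - y)) = fun x => ipartial s g (x - y).
Proof.
elim: s => [//|i s IH] /=; apply/funext => x; rewrite IH /derive.
by under eq_fun do rewrite /= -addrA.
Qed.

Lemma smooth_translate g y : smooth g -> smooth (fun x => g (x - y)).
Proof.
move=> sg s; rewrite ipartial_translate; split=> [x|i x].
  apply: (@continuous_comp _ _ _ (fun z : E => z - y) (ipartial s g)).
    by apply: continuousB => //; exact: cst_continuous.
  exact: (sg s).1.
have /derivableP/is_derive_translate := (sg s).2 i (x - y).
exact: @ex_derive.
Qed.

Lemma smooth_is_derive g s i x : smooth g ->
  is_derive x (dir i) (ipartial s g) (ipartial (i :: s) g x).
Proof. by move=> sg; apply/derivableP; exact: (sg s).2. Qed.

Lemma smooth0 : smooth (fun _ : E => 0 : R).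
Proof.
by move=> s; rewrite ipartial0; split=> *; [exact: cst_continuous|exact: derivable_cst].
Qed.

Lemma smoothD g h : smooth g -> smooth h -> smooth (fun x => g x + h x).
Proof.
move=> sg sh; have := smooth_lin 1 1 sg sh.
by under eq_fun do rewrite !mul1r.
Qed.

Lemma smoothB g h : smooth g -> smooth h -> smooth (fun x => g x - h x).
Proof.
move=> sg sh; have := smooth_lin 1 (-1) sg sh.
by under eq_fun do rewrite mul1r mulN1r.
Qed.

Lemma smoothZ (a : R) g : smooth g -> smooth (fun x => a * g x).
Proof.
move=> sg; have := smooth_lin a 0 sg sg.
by under eq_fun do rewrite mul0r addr0.
Qed.

Lemma ipartialD s g h : smooth g -> smooth h ->
  ipartial s (fun x => g x + h x) = fun x => ipartial s g x + ipartial s h x.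
Proof.
move=> sg sh; have := ipartial_lin 1 1 s sg sh.
by under eq_fun do rewrite !mul1r; move=> ->; apply/funext => x; rewrite !mul1r.
Qed.

Lemma ipartialB s g h : smooth g -> smooth h ->
  ipartial s (fun x => g x - h x) = fun x => ipartial s g x - ipartial s h x.
Proof.
move=> sg sh; have := ipartial_lin 1 (-1) s sg sh.
by under eq_fun do rewrite mul1r mulN1r; move=> ->; apply/funext => x; rewrite mul1r mulN1r.
Qed.

Lemma ipartialZ s (a : R) g : smooth g ->
  ipartial s (fun x => a * g x) = fun x => a * ipartial s g x.
Proof.
move=> sg; have := ipartial_lin a 0 s sg sg.
by under eq_fun do rewrite mul0r addr0; move=> ->; apply/funext => x; rewrite mul0r addr0.
Qed.

Lemma smooth_sum (I : Type) (r : seq I) (F : I -> E -> R) :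
  (forall i, smooth (F i)) -> smooth (fun x => \sum_(i <- r) F i x).
Proof.
move=> sF; elim: r => [|i r IH].
  by under eq_fun do rewrite big_nil; exact: smooth0.
under eq_fun do rewrite big_cons; exact: smoothD (sF i) IH.
Qed.

Lemma ipartial_sum (I : Type) (r : seq I) (F : I -> E -> R) s :
  (forall i, smooth (F i)) ->
  ipartial s (fun x => \sum_(i <- r) F i x) =
  fun x => \sum_(i <- r) ipartial s (F i) x.
Proof.
move=> sF; elim: r => [|i r IH].
  under eq_fun do rewrite big_nil; rewrite ipartial0.
  by under [in RHS]eq_fun do rewrite big_nil.
under eq_fun do rewrite big_cons; rewrite ipartialD//; last exact: smooth_sum.
by rewrite IH; under [in RHS]eq_fun do rewrite big_cons.
Qed.

End directional_derivatives.

(** * Weights, bounded families and approximation in the Schwartz topology *)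

Section seminorms.
Context {R : realType} {d : nat}.
Local Notation E := 'rV[R]_d.
Local Notation dir i := (delta_mx 0 i : 'rV[R]_d).
Implicit Types (g h : E -> R) (x y v : E) (P : set (E -> R)).

(** The product form makes the weight submultiplicative under addition ([weightD]) and lets sums
    over lattice boxes and Gaussian bounds factor over the coordinates. *)
Definition weight x : R := \prod_i (1 + `|x 0 i|).

Lemma weight_ge1 x : 1 <= weight x.
Proof.
rewrite /weight; elim/big_ind : _ => // [a b a1 b1|i _]; last by rewrite lerDl.
by rewrite -[1]mulr1 ler_pM.
Qed.

Lemma weight_gt0 x : 0 < weight x.
Proof. exact: lt_le_trans ltr01 (weight_ge1 x). Qed.

Lemma weightX_gt0 x m : 0 < weight x ^+ m.
Proof. by rewrite exprn_gt0// weight_gt0. Qed.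

Lemma weightX_le x m n : (m <= n)%N -> weight x ^+ m <= weight x ^+ n.
Proof. by move=> mn; apply: ler_weXn2l => //; exact: weight_ge1. Qed.

Lemma weightD x y : weight (x + y) <= weight x * weight y.
Proof.
rewrite /weight -big_split /=; apply: ler_prod => i _.
rewrite addr_ge0//= !mxE.
apply: (@le_trans _ _ (1 + (`|x 0 i| + `|y 0 i|))); first by rewrite lerD2l ler_normD.
have := mulr_ge0 (normr_ge0 (x 0 i)) (normr_ge0 (y 0 i)); lra.
Qed.

Lemma sum_norm_le_weight x : \sum_i `|x 0 i| <= weight x.
Proof.
(* The additional 1 is what the induction over coordinates needs. *)
suff : 1 + \sum_i `|x 0 i| <= weight x by apply: le_trans; rewrite lerDr.
rewrite /weight; elim: (index_enum _) => [|i s IH].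
  by rewrite !big_nil addr0.
rewrite !big_cons.
apply: (@le_trans _ _ ((1 + `|x 0 i|) * (1 + \sum_(j <- s) `|x 0 j|))).
  have := mulr_ge0 (normr_ge0 (x 0 i)) (sumr_ge0 _ (fun j _ => normr_ge0 (x 0 j)) :
    0 <= \sum_(j <- s) `|x 0 j|); lra.
by apply: ler_wpM2l => //; rewrite addr_ge0.
Qed.

Lemma norm_coord_le_weight x i : 1 + `|x 0 i| <= weight x.
Proof.
rewrite /weight (bigD1 i)//= ler_peMr ?addr_ge0//.
elim/big_ind : _ => // [a b a1 b1|j _]; last by rewrite lerDl.
by rewrite -[1]mulr1 ler_pM.
Qed.

Local Notation nondecr := (sorted (fun i j : 'I_d => (i <= j)%N)).

(* Only nondecreasing lists of directions correspond to multi-indices. *)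
Definition sbound m N g (C : R) := forall s x, nondecr s ->
  (size s <= N)%N -> weight x ^+ m * `|ipartial s g x| <= C.

Lemma sbound_weaken m N m' N' g C C' : sbound m' N' g C' ->
  (m <= m')%N -> (N <= N')%N -> C' <= C -> sbound m N g C.
Proof.
move=> gC mm' NN' CC' s x ss sN; apply: le_trans _ CC'.
apply: le_trans (gC s x ss (leq_trans sN NN')).
by apply: ler_wpM2r => //; exact: weightX_le.
Qed.

Lemma sboundD m N g h C D : smooth g -> smooth h ->
  sbound m N g C -> sbound m N h D -> sbound m N (fun x => g x + h x) (C + D).
Proof.
move=> sg sh gC hD s x ss sN; rewrite ipartialD//.
apply: le_trans (lerD (gC s x ss sN) (hD s x ss sN)).
by rewrite -mulrDr ler_wpM2l ?ler_normD// ltW// weightX_gt0.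
Qed.

Lemma sboundB m N g h C D : smooth g -> smooth h ->
  sbound m N g C -> sbound m N h D -> sbound m N (fun x => g x - h x) (C + D).
Proof.
move=> sg sh gC hD s x ss sN; rewrite ipartialB//.
apply: le_trans (lerD (gC s x ss sN) (hD s x ss sN)).
by rewrite -mulrDr ler_wpM2l ?ler_normB// ltW// weightX_gt0.
Qed.

Lemma sboundZ m N (a : R) g C : smooth g ->
  sbound m N g C -> sbound m N (fun x => a * g x) (`|a| * C).
Proof.
move=> sg gC s x ss sN; rewrite ipartialZ// normrM mulrCA.
by rewrite ler_wpM2l// gC.
Qed.

(** The constant depends on [m] and [N] but not on the index. With [I] equal to [unit] this says
    that a single real function is Schwartz. *)
Definition bounded_family (I : Type) (u : I -> E -> R) :=
  (forall i, smooth (u i)) /\ forall m N, exists C, forall i, sbound m N (u i) C.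

Lemma bounded_familyP (I : Type) (u : I -> E -> R) :
  (forall i, smooth (u i)) ->
  (forall m s, nondecr s -> exists C : R, forall i x,
    weight x ^+ m * `|ipartial s (u i) x| <= C) ->
  bounded_family u.
Proof.
move=> su H; split=> // m N.
(* Lists that are not nondecreasing get the dummy constant 0, so that [choice] applies; the
   constants of the finitely many lists of length at most [N] are then added up. *)
have {}H (s : seq 'I_d) : exists C : R, nondecr s -> forall i x,
    weight x ^+ m * `|ipartial s (u i) x| <= C.
  by have [/(H m)[C HC]|ns] := boolP (nondecr s); [exists C|exists 0].
have [F HF] := choice H.
exists (\sum_(k < N.+1) \sum_(t : k.-tuple 'I_d) `|F t|) => i s x ss sN.
apply: le_trans (HF s ss i x) _; apply: le_trans (ler_norm _) _.
have sN' : (size s < N.+1)%N by [].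
rewrite (bigD1 (Ordinal sN'))//= (bigD1 (in_tuple s))//= -addrA lerDl.
by rewrite addr_ge0 ?sumr_ge0// => ? _; rewrite sumr_ge0.
Qed.

Lemma bounded_familyB (I : Type) (u w : I -> E -> R) :
  bounded_family u -> bounded_family w ->
  bounded_family (fun i x => u i x - w i x).
Proof.
move=> [su bu] [sw bw]; split=> [i|m N]; first exact: smoothB.
have [[C HC] [D HD]] := (bu m N, bw m N).
by exists (C + D) => i; exact: sboundB.
Qed.

(** The square of w^m |g| is the product of w^(2m) |g| and |g|: boundedness at the doubled weight
    and smallness without weight give smallness at weight m. *)
Lemma weight_interpolation g m (C D eps : R) : 0 < eps ->
  (forall x, weight x ^+ (m + m) * `|g x| <= C) -> (forall x, `|g x| <= D) ->
  D * (`|C| + 1) <= eps ^+ 2 -> forall x, weight x ^+ m * `|g x| <= eps.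
Proof.
move=> e0 gC gD De x.
have w0 := weightX_gt0 x m.
rewrite -(@ler_pXn2r _ 2) ?nnegrE ?mulr_ge0//; [|exact: ltW..].
apply: le_trans De; rewrite exprMn expr2 -exprD (expr2 `|_|) mulrA.
apply: le_trans (_ : (`|C| + 1) * D <= _); last by rewrite mulrC.
apply: ler_pM => //; first by rewrite mulr_ge0// ltW// weightX_gt0.
apply: le_trans (gC x) _; apply: le_trans (ler_norm _) _; by rewrite lerDl.
Qed.

(* On a bounded family, smallness of the functions propagates to all
   derivatives (Landau) and to all weights, so convergence in the Schwartz
   topology reduces to uniform convergence. *)
Lemma bounded_family_interpolation (I : Type) (u : I -> E -> R) m N (eps : R) :
  bounded_family u -> 0 < eps ->
  exists2 delta : R, 0 < delta & forall i,
    (forall x, `|u i x| <= delta) -> sbound m N (u i) eps.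
Proof.
move=> [su bu].
have unweighted : forall e : R, 0 < e -> exists2 delta : R, 0 < delta & forall i,
    (forall x, `|u i x| <= delta) -> sbound 0 N (u i) e.
  elim: N => [|N IH] e e0.
    exists e => // i ui [|//] x _ _; by rewrite expr0 mul1r ui.
  have [C HC] := bu 0%N N.+2.
  (* With this step length and the bound e a / 4 on the lower derivative, both terms of Landau's
     inequality equal e / 2. *)
  pose C1 := `|C| + 1; pose a := e / (2 * C1).
  have C10 : 0 < C1 by rewrite ltr_wpDl.
  have a0 : 0 < a by rewrite divr_gt0// mulr_gt0.
  have D0 : 0 < Num.min e (e * a / 4) by rewrite lt_min e0 divr_gt0// mulr_gt0.
  have [delta delta0 IHd] := IH _ D0.
  exists delta => // i ui [|j s] x ss sN.
    apply: le_trans (IHd i ui [::] x _ _) _ => //.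
    by rewrite ge_min lexx.
  have Hs y : `|ipartial s (u i) y| <= e * a / 4.
    have := IHd i ui s y (path_sorted ss) sN; rewrite expr0 mul1r => /le_trans; apply.
    by rewrite ge_min lexx orbT.
  (* Repeating the head keeps the list nondecreasing, so the second derivative is covered by the
     bound of order [N.+2]. *)
  have Hs2 y : `|ipartial (j :: j :: s) (u i) y| <= C1.
    have := HC i (j :: j :: s) y; rewrite expr0 mul1r /= leqnn => /(_ ss sN)/le_trans; apply.
    by apply: le_trans (ler_norm _) _; rewrite lerDl.
  rewrite expr0 mul1r.
  apply: le_trans (landau_step x a0 (fun y => smooth_is_derive s j y (su i))
    (fun y => smooth_is_derive (j :: s) j y (su i)) Hs Hs2) _.
  rewrite /a (_ : _ + _ = e)//; field; by rewrite !gt_eqF//=.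
move=> e0; have [C HC] := bu (m + m)%N N.
have D0 : 0 < eps ^+ 2 / (`|C| + 1) by rewrite divr_gt0 ?exprn_gt0// ltr_wpDl.
have [delta delta0 Hd] := unweighted _ D0; exists delta => // i ui s x ss sN.
apply: (@weight_interpolation _ _ C (eps ^+ 2 / (`|C| + 1))) => // [y|y|].
- exact: HC.
- by have := Hd i ui s y ss sN; rewrite expr0 mul1r.
- by rewrite divfK// gt_eqF// ltr_wpDl.
Qed.

(** By induction on the list, all iterated partials stay inside [K]. Since [K] consists of families,
    one formal derivative serves all indices at once. *)
Lemma derivation_closed_ipartial (I : Type) (K : (I -> E -> R) -> Prop) :
  (forall F i, K F -> continuous (F i)) ->
  (forall F j, K F -> exists2 F', K F' &
    forall i x, is_derive x (dir j) (F i) (F' i x)) ->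
  forall F, K F -> (forall i, smooth (F i)) /\
    forall s, exists2 F', K F' & forall i, ipartial s (F i) = F' i.
Proof.
move=> Kc Kd F KF.
have H s : exists2 F', K F' & forall i, ipartial s (F i) = F' i.
  elim: s => [|j s [F' KF' FF']]; first by exists F.
  have [F'' KF'' dF''] := Kd F' j KF'.
  exists F'' => // i; apply/funext => x; rewrite /= FF'.
  exact: (@derive_val _ _ _ _ _ _ _ (dF'' i x)).
split=> // i s; have [F' KF' ->] := H s; split=> [|j x]; first exact: Kc.
have [F'' _ dF''] := Kd F' j KF'.
exact: (@ex_derive _ _ _ _ _ _ _ (dF'' i x)).
Qed.

(** Every iterated partial of [F] is a member of [K], so a uniform sup bound on each member, for
    each weight, already controls all seminorms. *)
Lemma derivation_closed_bounded_family (I : Type) (K : (I -> E -> R) -> Prop) :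
  (forall F i, K F -> continuous (F i)) ->
  (forall F j, K F -> exists2 F', K F' &
    forall i x, is_derive x (dir j) (F i) (F' i x)) ->
  (forall F m, K F -> exists C : R, forall i x, weight x ^+ m * `|F i x| <= C) ->
  forall F, K F -> bounded_family F.
Proof.
move=> Kc Kd Kb F KF; have [sF HF] := derivation_closed_ipartial Kc Kd KF.
apply: bounded_familyP => // m s _; have [F' KF' FF'] := HF s.
have [C HC] := Kb F' m KF'.
by exists C => i x; rewrite FF'.
Qed.

(** This is closure in the Schwartz topology for real functions. A single pair [m], [N] is enough
    because the bounds [sbound] increase with both. *)
Definition approximable P g := smooth g /\ forall m N (eps : R), 0 < eps ->
  exists p, [/\ P p, smooth p & sbound m N (fun x => g x - p x) eps].

Lemma approximable_trans P Q g :
  (forall p, Q p -> approximable P p) -> approximable Q g -> approximable P g.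
Proof.
move=> QP [sg gQ]; split=> [|m N eps e0]; first exact: sg.
have e20 : 0 < eps / 2 by rewrite divr_gt0.
have [q [Qq sq gq]] := gQ m N _ e20.
have [p [Pp sp qp]] := (QP q Qq).2 m N _ e20.
exists p; split; [exact: Pp|exact: sp|].
have -> : (fun x => g x - p x) = fun x => (g x - q x) + (q x - p x).
  by apply/funext => x; rewrite addrA subrK.
rewrite (splitr eps).
exact: sboundD (smoothB sg sq) (smoothB sq sp) gq qp.
Qed.

Lemma approximable_sub P g : smooth g -> P g -> approximable P g.
Proof.
move=> sg Pg; split=> [|m N eps e0]; first exact: sg.
exists g; split; [exact: Pg|exact: sg|] => s x _ _.
under eq_fun do rewrite subrr.
by rewrite ipartial0 normr0 mulr0 ltW.
Qed.

Lemma approximable_lin P (a : R) g h :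
  (forall p q b, P p -> P q -> P (fun x => p x + b * q x)) ->
  approximable P g -> approximable P h ->
  approximable P (fun x => g x + a * h x).
Proof.
move=> Plin [sg gP] [sh hP]; split=> [|m N eps e0].
  exact: smoothD sg (smoothZ a sh).
have e20 : 0 < eps / 2 by rewrite divr_gt0.
have a0 : 0 < `|a| + 1 by rewrite ltr_wpDl.
have [p [Pp sp gp]] := gP m N _ e20.
have [q [Pq sq hq]] := hP m N _ (divr_gt0 e20 a0).
exists (fun x => p x + a * q x); split.
- exact: Plin.
- exact: smoothD sp (smoothZ a sq).
have -> : (fun x => g x + a * h x - (p x + a * q x)) =
    fun x => (g x - p x) + a * (h x - q x).
  by apply/funext => x; ring.
have shq := smoothB sh sq.
have H := sboundD (smoothB sg sp) (smoothZ a shq) gp (sboundZ a shq hq).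
apply: (sbound_weaken H (leqnn m) (leqnn N)).
rewrite [leRHS]splitr lerD2l mulrCA ler_piMr ?ltW//.
by rewrite ltr_pdivrMr// mul1r ltrDl.
Qed.

Lemma approximable_sum P (I : Type) (r : seq I) (a : I -> R) (F : I -> E -> R) :
  P (fun=> 0) -> (forall p q b, P p -> P q -> P (fun x => p x + b * q x)) ->
  (forall i, approximable P (F i)) ->
  approximable P (fun x => \sum_(i <- r) a i * F i x).
Proof.
move=> P0 Plin PF; elim: r => [|i r IH].
  under eq_fun do rewrite big_nil.
  by apply: approximable_sub => //; exact: smooth0.
under eq_fun do rewrite big_cons addrC; exact: approximable_lin.
Qed.

(** By interpolation on the bounded family of errors, uniform convergence is all that has to be
    checked. *)
Lemma approximable_limit P g (I : Type) (u : I -> E -> R) :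
  smooth g -> (forall i, P (u i)) ->
  bounded_family (fun i x => g x - u i x) -> (forall i, smooth (u i)) ->
  (forall eps : R, 0 < eps -> exists i, forall x, `|g x - u i x| <= eps) ->
  approximable P g.
Proof.
move=> sg Pu bu su ucvg; split=> [|m N eps e0]; first exact: sg.
have [delta delta0 Hd] := bounded_family_interpolation m N bu e0.
have [i Hi] := ucvg _ delta0.
by exists (u i); split; [exact: Pu|exact: su|exact: Hd].
Qed.

End seminorms.

(** * Taylor polynomials of the exponential *)

Section truncated_exponential.
Context {R : realType}.
Implicit Types (z a : R) (n m k : nat).

(** Here [n] counts terms, so the degree is [n - 1] and the derivative of [expS n] is [expS n.-1],
    also for [n = 0]. *)
Definition expS n z : R := \sum_(k < n) z ^+ k / k`!%:R.

Lemma expSS n z : expS n.+1 z = expS n z + z ^+ n / n`!%:R.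
Proof. by rewrite /expS big_ord_recr. Qed.

Lemma expS_cvg z : (expS ^~ z) @ \oo --> expR z.
Proof.
rewrite (_ : expS ^~ z = series (exp_coeff z)); first exact: is_cvg_series_exp_coeff.
by apply/funext => n; rewrite /series /= big_mkord.
Qed.

Lemma expS_homo n m z : 0 <= z -> (n <= m)%N -> expS n z <= expS m z.
Proof.
move=> z0 /subnK <-; elim: (m - n)%N => [//|k IH].
by rewrite addSn expSS; apply: le_trans IH _; rewrite lerDl divr_ge0 ?exprn_ge0.
Qed.

Lemma expS_le_expR n z : 0 <= z -> expS n z <= expR z.
Proof.
move=> z0; apply: (ler_cvg_to (cvg_cst (expS n z)) (@expS_cvg z)).
by exists n => // m /= nm; exact: expS_homo.
Qed.

Lemma norm_expS n z : `|expS n z| <= expR `|z|.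
Proof.
apply: le_trans (expS_le_expR n (normr_ge0 z)).
apply: le_trans (ler_norm_sum _ _ _) _; apply: ler_sum => k _.
by rewrite normrM normrX normfV [X in _ / X <= _]ger0_norm.
Qed.

Lemma exprn_le_fact_expR n z : 0 <= z -> z ^+ n <= n`!%:R * expR z.
Proof.
move=> z0; rewrite -ler_pdivrMl ?ltr0n ?fact_gt0// mulrC.
apply: le_trans (expS_le_expR n.+1 z0); rewrite expSS lerDr.
by rewrite /expS sumr_ge0// => k _; rewrite divr_ge0 ?exprn_ge0.
Qed.

(** For k >= n one has |z|^k <= 2^-n (2 |z|)^k, which bounds the tail by 2^-n times the exponential
    series at 2 |z|. The estimate is proved for partial sums and passed to the limit. *)
Lemma expR_sub_expS n z : `|expR z - expS n z| <= 2 ^- n * expR (2 * `|z|).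
Proof.
have H : (fun m => `|expS m z - expS n z|) @ \oo --> `|expR z - expS n z|.
  by apply: cvg_norm; apply: cvgB; [exact: expS_cvg|exact: cvg_cst].
apply: (ler_cvg_to H (cvg_cst _)); exists n => // m /= nm.
apply: (@le_trans _ _ (2 ^- n * expS m (2 * `|z|))); last first.
  by rewrite ler_wpM2l ?invr_ge0 ?exprn_ge0// expS_le_expR// mulr_ge0.
rewrite -(subnK nm); elim: (m - n)%N => [|k IH].
  by rewrite add0n subrr normr0 mulr_ge0 ?invr_ge0 ?exprn_ge0// sumr_ge0// => i _;
    rewrite divr_ge0 ?exprn_ge0 ?mulr_ge0.
rewrite addSn !expSS addrAC mulrDr.
apply: le_trans (ler_normD _ _) (lerD IH _).
rewrite normrM normrX normfV [X in _ / X]ger0_norm// mulrA ler_wpM2r ?invr_ge0//.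
rewrite exprMn mulrA ler_peMl ?exprn_ge0// mulrC ler_pdivlMr ?exprn_gt0// mul1r.
by rewrite ler_weXn2l ?leq_addl// ler1n.
Qed.

Lemma is_derive_expS n z : is_derive z 1 (expS n) (expS n.-1 z).
Proof.
elim: n => [|[|n] IH].
- rewrite (_ : expS 0 = cst 0); last by apply/funext => y; rewrite /expS big_ord0.
  exact: is_derive_cst.
- rewrite (_ : expS 1 = cst 1); last first.
    by apply/funext => y; rewrite /expS big_ord1 expr0 divr1.
  by rewrite [X in is_derive _ _ _ X]/expS big_ord0; exact: is_derive_cst.
have -> : expS n.+2 = expS n.+1 + (n.+1`!%:R)^-1 *: (id ^+ n.+1 : R -> R^o).
  by apply/funext => y; rewrite expSS mulrC !fctE.
have dX : is_derive z (1 : R) (id ^+ n.+1 : R -> R) ((n.+1%:R * z ^+ n) *: 1).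
  exact: (is_deriveX n.+1 (is_derive_id z (1 : R))).
apply: (is_derive_eq (is_deriveD IH (is_deriveZ (n.+1`!%:R)^-1 dX))).
rewrite /= expSS; congr (_ + _).
rewrite [X in _ *: X]mulr1 [LHS]mulrC factS natrM invfM [n.+1%:R * _]mulrC.
by rewrite mulrA mulfK// pnatr_eq0.
Qed.

(** Since 1 + |a| <= (2 / eta) (eta + eta a^2), the m-th power is dominated by m! exp (eta + eta
    a^2), up to the factor (2 / eta)^m. *)
Lemma weight_expR1 m (eta : R) : 0 < eta ->
  exists2 C, 0 <= C & forall a, (1 + `|a|) ^+ m * expR (- (eta * a ^+ 2)) <= C.
Proof.
move=> eta0; have e20 : 0 <= 2 / eta by rewrite divr_ge0// ltW.
exists ((2 / eta) ^+ m * (m`!%:R * expR eta)).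
  by apply: mulr_ge0; [exact: exprn_ge0|rewrite mulr_ge0 ?expR_ge0].
move=> a; have a2 : 0 <= eta + eta * a ^+ 2.
  by have := mulr_ge0 (ltW eta0) (sqr_ge0 a); lra.
have H1 : (1 + `|a|) ^+ m <= ((2 / eta) * (eta + eta * a ^+ 2)) ^+ m.
  rewrite lerXn2r ?nnegrE ?addr_ge0//; last first.
    have -> : 2 / eta * (eta + eta * a ^+ 2) = 2 * (1 + a ^+ 2).
      by field; rewrite gt_eqF.
    rewrite -(real_normK (num_real a)); have := sqr_ge0 (`|a| - 1); nra.
  exact: mulr_ge0.
apply: (@le_trans _ _ (((2 / eta) ^+ m * (m`!%:R * expR (eta + eta * a ^+ 2))) *
    expR (- (eta * a ^+ 2)))).
  rewrite ler_wpM2r ?expR_ge0//; apply: le_trans H1 _; rewrite exprMn.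
  by rewrite ler_wpM2l ?(exprn_ge0 _ e20)// exprn_le_fact_expR.
by rewrite -!mulrA -expRD addrK.
Qed.

End truncated_exponential.

(** * Polynomials times Gaussians, and moving the exponent *)

Section polynomial_gaussians.
Context {R : realType} {d : nat}.
Local Notation E := 'rV[R]_d.
Local Notation dir i := (delta_mx 0 i : 'rV[R]_d).
Implicit Types (p q Q : E -> R) (x y v : E) (P : set (E -> R)).

(** A syntactic closure: derivatives, growth bounds and expansions into monomials all follow by
    induction on it. *)
Inductive polyfun : (E -> R) -> Prop :=
| polyfun_cst c : polyfun (fun=> c)
| polyfun_coord i : polyfun (fun x => x 0 i)
| polyfunD p q : polyfun p -> polyfun q -> polyfun (fun x => p x + q x)
| polyfunM p q : polyfun p -> polyfun q -> polyfun (fun x => p x * q x).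

Lemma polyfun_scale (a : R) p : polyfun p -> polyfun (fun x => a * p x).
Proof. by move=> Hp; apply: polyfunM => //; exact: polyfun_cst. Qed.

Lemma polyfunB p q : polyfun p -> polyfun q -> polyfun (fun x => p x - q x).
Proof.
move=> Hp Hq; have := polyfunD Hp (polyfun_scale (-1) Hq).
by under eq_fun do rewrite mulN1r.
Qed.

Lemma polyfunX p n : polyfun p -> polyfun (fun x => p x ^+ n).
Proof.
move=> Hp; elim: n => [|n IH].
  by under eq_fun do rewrite expr0; exact: polyfun_cst.
by under eq_fun do rewrite exprS; exact: polyfunM.
Qed.

Lemma polyfun_sum (I : Type) (r : seq I) (F : I -> E -> R) :
  (forall i, polyfun (F i)) -> polyfun (fun x => \sum_(i <- r) F i x).
Proof.
move=> HF; elim: r => [|i r IH].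
  by under eq_fun do rewrite big_nil; exact: polyfun_cst.
by under eq_fun do rewrite big_cons; exact: polyfunD.
Qed.

Lemma polyfun_expS n q : polyfun q -> polyfun (fun x => expS n (q x)).
Proof.
move=> Hq; apply: polyfun_sum => k; under eq_fun do rewrite mulrC.
by apply: polyfun_scale; exact: polyfunX.
Qed.

Lemma polyfun_continuous p : polyfun p -> continuous p.
Proof.
elim=> {p} [c|i|p q _ cp _ cq|p q _ cp _ cq] x.
- exact: cst_continuous.
- exact: coord_continuous.
- exact: (continuousD (cp x) (cq x)).
- exact: (continuousM (cp x) (cq x)).
Qed.

Lemma polyfun_derive p j : polyfun p ->
  exists2 p', polyfun p' & forall x, is_derive x (dir j) p (p' x).
Proof.
elim=> {p} [c|i|p q Hp [p' Hp' dp] Hq [q' Hq' dq]|p q Hp [p' Hp' dp] Hq [q' Hq' dq]].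
- by exists (fun=> 0) => [|x]; [exact: polyfun_cst|exact: is_derive_cst].
- exists (fun=> dir j 0 i) => [|x]; [exact: polyfun_cst|exact: is_derive_coord].
- exists (fun x => p' x + q' x) => [|x]; [exact: polyfunD|exact: is_deriveD].
- exists (fun x => p x * q' x + q x * p' x) => [|x]; last exact: is_deriveM.
  by apply: polyfunD; exact: polyfunM.
Qed.

Lemma polyfun_bound p : polyfun p ->
  exists (C : R) m, forall x, `|p x| <= C * weight x ^+ m.
Proof.
elim=> {p} [c|i|p q _ [C [m HC]] _ [D [n HD]]|p q _ [C [m HC]] _ [D [n HD]]].
- by exists `|c|, 0%N => x; rewrite expr0 mulr1.
- exists 1, 1%N => x; rewrite mul1r expr1.
  by apply: le_trans (norm_coord_le_weight x i); rewrite lerDr.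
- exists (`|C| + `|D|), (m + n)%N => x; apply: le_trans (ler_normD _ _) _.
  rewrite mulrDl; apply: lerD.
    apply: le_trans (HC x) _.
    apply: le_trans (_ : `|C| * weight x ^+ m <= _).
      by rewrite ler_wpM2r ?ler_norm// ltW// weightX_gt0.
    by rewrite ler_wpM2l ?weightX_le ?leq_addr.
  apply: le_trans (HD x) _.
  apply: le_trans (_ : `|D| * weight x ^+ n <= _).
    by rewrite ler_wpM2r ?ler_norm// ltW// weightX_gt0.
  by rewrite ler_wpM2l ?weightX_le ?leq_addl.
- exists (C * D), (m + n)%N => x; rewrite normrM exprD mulrACA.
  by apply: ler_pM.
Qed.

Lemma polyfun_monomials p : polyfun p ->
  exists l : seq (R * multiindex d), forall x,
    p x = \sum_(a <- l) a.1 * monomial a.2 x.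
Proof.
elim=> {p} [c|i|p q _ [k Hk] _ [l Hl]|p q _ [k Hk] _ [l Hl]].
- exists [:: (c, [ffun=> 0%N])] => x; rewrite big_seq1 /monomial big1 ?mulr1// => i _.
  by rewrite ffunE expr0.
- exists [:: (1, [ffun j => (j == i) : nat])] => x; rewrite big_seq1 mul1r /monomial.
  rewrite (bigD1 i)//= ffunE eqxx expr1 big1 ?mulr1// => j ji.
  by rewrite ffunE (negbTE ji) expr0.
- by exists (k ++ l) => x; rewrite big_cat /= Hk Hl.
- exists [seq (a.1 * b.1, [ffun i => (a.2 i + b.2 i)%N] : multiindex d) |
    a : R * multiindex d <- k, b : R * multiindex d <- l] => x.
  rewrite Hk Hl big_allpairs_dep /= mulr_suml; apply: eq_bigr => a _.
  rewrite mulr_sumr; apply: eq_bigr => b _; rewrite mulrACA; congr (_ * _).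
  rewrite /monomial -big_split /=; apply: eq_bigr => i _.
  by rewrite ffunE exprD.
Qed.

Definition sqnorm x : R := \sum_i x 0 i ^+ 2.

Lemma sqnorm_ge0 x : 0 <= sqnorm x.
Proof. by apply: sumr_ge0 => i _; exact: sqr_ge0. Qed.

(** Weight and Gaussian both factor over the coordinates, so the one-variable constant is raised to
    the power [d]. *)
Lemma weight_gaussian m (eta : R) : 0 < eta ->
  exists2 C : R, 0 <= C & forall x, weight x ^+ m * expR (- (eta * sqnorm x)) <= C.
Proof.
move=> /(weight_expR1 m)[C C0 HC]; exists (C ^+ d) => [|x]; first exact: exprn_ge0.
rewrite /sqnorm mulr_sumr -sumrN expR_sum /weight -prodrXl -big_split /=.
have -> : C ^+ d = \prod_(i < d) C by rewrite prodr_const card_ord.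
by apply: ler_prod => i _; rewrite HC mulr_ge0 ?exprn_ge0 ?addr_ge0 ?expR_ge0.
Qed.

(** The bound on q gives 2 |q| - Q <= - Q / 2 + 2 c, so half of the Gaussian decay survives the
    factor exp (2 |q|) of the Taylor remainder and absorbs [p] and the weight. *)
Lemma dominated_gaussian p q Q (eta c : R) m : 0 < eta -> polyfun p ->
  (forall x, `|q x| <= Q x / 4 + c) -> (forall x, eta * sqnorm x - c <= Q x) ->
  exists2 C : R, 0 <= C & forall x,
    weight x ^+ m * (`|p x| * (expR (2 * `|q x|) * expR (- Q x))) <= C.
Proof.
move=> eta0 /polyfun_bound[C [n HC]] Hq HQ.
have eta20 : 0 < eta / 2 by rewrite divr_gt0.
have [D D0 HD] := weight_gaussian (m + n) eta20.
exists (`|C| * expR (5 / 2 * c) * D) => [|x]; first by rewrite !mulr_ge0 ?expR_ge0.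
have -> : expR (2 * `|q x|) * expR (- Q x) = expR (2 * `|q x| - Q x) by rewrite expRD.
have H1 : expR (2 * `|q x| - Q x) <= expR (5 / 2 * c) * expR (- (eta / 2 * sqnorm x)).
  by rewrite -expRD ler_expR; move: (Hq x) (HQ x) => ? ?; lra.
have H2 : `|p x| <= `|C| * weight x ^+ n.
  by apply: le_trans (HC x) _; rewrite ler_wpM2r ?ler_norm// ltW// weightX_gt0.
apply: (@le_trans _ _ (weight x ^+ m * ((`|C| * weight x ^+ n) *
   (expR (5 / 2 * c) * expR (- (eta / 2 * sqnorm x)))))).
  rewrite ler_wpM2l ?(ltW (weightX_gt0 _ _))//.
  by apply: ler_pM => //; exact: expR_ge0.
have -> : weight x ^+ m * (`|C| * weight x ^+ n * (expR (5 / 2 * c) *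
    expR (- (eta / 2 * sqnorm x)))) =
  (`|C| * expR (5 / 2 * c)) * (weight x ^+ (m + n) * expR (- (eta / 2 * sqnorm x))).
  by rewrite exprD; ring.
by rewrite ler_wpM2l// mulr_ge0// expR_ge0.
Qed.

Section taylor.
Variables (q Q : E -> R) (eta c : R).
Hypotheses (eta0 : 0 < eta) (Hq : polyfun q) (HQ : polyfun Q).
Hypotheses (qQ : forall x, `|q x| <= Q x / 4 + c).
Hypotheses (Q_lb : forall x, eta * sqnorm x - c <= Q x).

(* Sequences of functions: the Taylor approximants and their limit generate a
   class that is closed under differentiation with bounds uniform in [n]. *)
Inductive taylor_class : (nat -> E -> R) -> Prop :=
| taylor_trunc p j : polyfun p ->
    taylor_class (fun n x => p x * (expS (n - j) (q x) * expR (- Q x)))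
| taylor_full p : polyfun p ->
    taylor_class (fun n x => p x * (expR (q x) * expR (- Q x)))
| taylor_add F G : taylor_class F -> taylor_class G ->
    taylor_class (fun n x => F n x + G n x).

Lemma expRN_continuous p : polyfun p -> continuous (fun x => expR (- p x)).
Proof.
move=> Hp x; apply: (@continuous_comp _ _ _ (fun x => - p x) expR).
  by apply: continuousN; exact: polyfun_continuous.
exact: continuous_expR.
Qed.

Lemma taylor_class_continuous F n : taylor_class F -> continuous (F n).
Proof.
have cQ := expRN_continuous HQ.
elim=> {F} [p j Hp|p Hp|F G _ cF _ cG] x.
- have cS := polyfun_continuous (polyfun_expS (n - j) Hq).
  have cp := polyfun_continuous Hp.
  exact: (continuousM (cp x) (continuousM (cS x) (cQ x))).
- have cE : continuous (fun x => expR (q x)).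
    move=> y; apply: (@continuous_comp _ _ _ q expR); first exact: polyfun_continuous.
    exact: continuous_expR.
  have cp := polyfun_continuous Hp.
  exact: (continuousM (cp x) (continuousM (cE x) (cQ x))).
- exact: (continuousD (cF x) (cG x)).
Qed.

Lemma is_derive_expRN Q' j : (forall x, is_derive x (dir j) Q (Q' x)) ->
  forall x, is_derive x (dir j) (fun x => expR (- Q x)) (expR (- Q x) * - Q' x).
Proof.
move=> dQ x; apply: (@is_derive_comp_real _ _ expR (fun x => - Q x)).
Qed.

Lemma taylor_class_derive F j : taylor_class F -> exists2 F', taylor_class F' &
  forall n x, is_derive x (dir j) (F n) (F' n x).
Proof.
have [[q' Hq' dq] [Q' HQ' dQ]] := (polyfun_derive j Hq, polyfun_derive j HQ).
elim=> {F} [p k Hp|p Hp|F G _ [F' TF dF] _ [G' TG dG]].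
- have [p' Hp' dp] := polyfun_derive j Hp.
  (* Differentiating the Taylor polynomial removes one term, recorded by the shift [k.+1]; the other
     two terms of the product rule keep the shift [k]. *)
  eexists; first apply: (taylor_add (taylor_trunc k (polyfunB Hp' (polyfunM Hp HQ')))
     (taylor_trunc k.+1 (polyfunM Hp Hq'))).
  move=> n x.
  have dS := is_derive_comp_real (is_derive_expS (n - k) (q x)) (dq x).
  have := is_deriveM (dp x) (is_deriveM dS (is_derive_expRN dQ x)).
  move=> /is_derive_eq; apply.
  by rewrite subnS !fctE /= /GRing.scale /=; ring.
- have [p' Hp' dp] := polyfun_derive j Hp.
  eexists; first apply: (taylor_full (polyfunD (polyfunB Hp' (polyfunM Hp HQ'))
     (polyfunM Hp Hq'))).
  move=> n x.
  have dS := is_derive_comp_real (is_derive_expR (q x)) (dq x).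
  have := is_deriveM (dp x) (is_deriveM dS (is_derive_expRN dQ x)).
  move=> /is_derive_eq; apply.
  by rewrite !fctE /= /GRing.scale /=; ring.
- exists (fun n x => F' n x + G' n x) => [|n x]; first exact: taylor_add.
  exact: is_deriveD.
Qed.

Lemma taylor_class_bounded F m : taylor_class F ->
  exists C : R, forall n x, weight x ^+ m * `|F n x| <= C.
Proof.
have aux p (b : E -> R) : polyfun p -> (forall x, `|b x| <= expR `|q x|) -> 
   forall x, weight x ^+ m * `|p x * (b x * expR (- Q x))| <=
     weight x ^+ m * (`|p x| * (expR (2 * `|q x|) * expR (- Q x))).
  move=> Hp bq x; rewrite !normrM (ger0_norm (expR_ge0 (- Q x))).
  rewrite ler_wpM2l ?(ltW (weightX_gt0 _ _))// ler_wpM2l// ler_wpM2r ?expR_ge0//.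
  apply: le_trans (bq x) _; rewrite ler_expR.
  by rewrite ler_peMl// ler1n.
elim=> {F} [p k Hp|p Hp|F G _ [C HC] _ [D HD]].
- have [C _ HC] := dominated_gaussian m eta0 Hp qQ Q_lb; exists C => n x.
  apply: le_trans (HC x); apply: (aux p (fun x => expS (n - k) (q x))) => // y.
  exact: norm_expS.
- have [C _ HC] := dominated_gaussian m eta0 Hp qQ Q_lb; exists C => n x.
  apply: le_trans (HC x); apply: (aux p (fun x => expR (q x))) => // y.
  by rewrite ger0_norm ?expR_ge0// ler_expR ler_norm.
- exists (C + D) => n x; apply: le_trans (lerD (HC n x) (HD n x)).
  by rewrite -mulrDr ler_wpM2l ?ler_normD// ltW// weightX_gt0.
Qed.

Lemma taylor_class_bounded_family F : taylor_class F -> bounded_family F.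
Proof.
apply: derivation_closed_bounded_family => [G n|G j|G m].
- exact: taylor_class_continuous.
- exact: taylor_class_derive.
- exact: taylor_class_bounded.
Qed.

(** The truncated products are again polynomials times e^(-Q), hence approximable by hypothesis.
    They form a bounded family and converge uniformly, with error at most a constant times 2^-n. *)
Lemma approximable_taylor P :
  (forall p, polyfun p -> approximable P (fun x => p x * expR (- Q x))) ->
  forall p, polyfun p -> approximable P (fun x => p x * expR (q x - Q x)).
Proof.
move=> HP p Hp.
apply: (@approximable_trans _ _ _ [set g | exists2 p, polyfun p &
   g = fun x => p x * expR (- Q x)]) => [_ [p' Hp' ->]|]; first exact: HP.
have -> : (fun x => p x * expR (q x - Q x)) =
   fun x => p x * (expR (q x) * expR (- Q x)).
  by apply/funext => x; rewrite expRD.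
have bfull := taylor_class_bounded_family (taylor_full Hp).
have btrunc := taylor_class_bounded_family (taylor_trunc 0 Hp).
apply: (@approximable_limit _ _ _ _ _
  (fun n x => p x * (expS (n - 0) (q x) * expR (- Q x)))).
- exact: bfull.1 0%N.
- move=> n; exists (fun x => p x * expS (n - 0) (q x)).
    by apply: polyfunM => //; exact: polyfun_expS.
  by apply/funext => x; rewrite mulrA.
- exact: bounded_familyB bfull btrunc.
- exact: btrunc.1.
move=> eps eps0; have [C C0 HC] := dominated_gaussian 0 eta0 Hp qQ Q_lb.
have [n Hn] : exists n, C / eps < 2 ^+ n.
  by exists (Num.bound (C / eps)); exact: upper_nthrootP.
exists n => x; rewrite subn0 -mulrBr -mulrBl !normrM (ger0_norm (expR_ge0 (- Q x))).
apply: (@le_trans _ _ (2 ^- n * C)); last first.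
  by rewrite mulrC ler_pdivrMr ?exprn_gt0// -ler_pdivrMl// mulrC ltW.
apply: (@le_trans _ _ (2 ^- n * (`|p x| * (expR (2 * `|q x|) * expR (- Q x))))).
  rewrite [leRHS]mulrCA ler_wpM2l// mulrA ler_wpM2r ?expR_ge0//.
  exact: expR_sub_expS.
by rewrite ler_wpM2l ?invr_ge0 ?exprn_ge0//; have := HC x; rewrite expr0 mul1r.
Qed.

End taylor.

(** This is the untruncated Taylor class for the exponent [q = 0]. *)
Lemma poly_gaussian_bounded_family p Q (eta c : R) : 0 < eta -> 0 <= c ->
  polyfun p -> polyfun Q -> (forall x, eta * sqnorm x - c <= Q x) ->
  bounded_family (fun (_ : unit) x => p x * expR (- Q x)).
Proof.
move=> eta0 c0 Hp HQ lb.
have ub x : `|0 : R| <= Q x / 4 + c.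
  rewrite normr0; have := lb x; have := mulr_ge0 (ltW eta0) (sqnorm_ge0 x); lra.
have [] := taylor_class_bounded_family eta0 (polyfun_cst 0) HQ ub lb
  (taylor_full _ _ Hp).
have -> : (fun x => p x * (expR 0 * expR (- Q x))) = fun x => p x * expR (- Q x).
  by apply/funext => x; rewrite expR0 mul1r.
move=> sG bG; split=> [_|m N]; first exact: sG 0%N.
by have [C HC] := bG m N; exists C => _; exact: HC 0%N.
Qed.

(* The exponent is moved from [Q0] to [Q1] along a segment, in steps small
   enough for the Taylor expansion of the quotient to converge. *)
Lemma approximable_gaussian P Q0 Q1 (eta K c : R) : 0 < eta ->
  polyfun Q0 -> polyfun Q1 ->
  (forall x, eta * sqnorm x - c <= Q0 x) -> (forall x, eta * sqnorm x - c <= Q1 x) ->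
  (forall x, `|Q1 x - Q0 x| <= K * sqnorm x + c) ->
  (forall p, polyfun p -> approximable P (fun x => p x * expR (- Q0 x))) ->
  forall p, polyfun p -> approximable P (fun x => p x * expR (- Q1 x)).
Proof.
move=> eta0 H0 H1 lb0 lb1 ub HP.
have c0 : 0 <= c.
  have S0 : sqnorm 0 = 0 by apply: big1 => i _; rewrite mxE expr0n.
  by have := le_trans (normr_ge0 _) (ub 0); rewrite S0 mulr0 add0r.
(* With this many steps the exponent changes by at most eta / 4 times [sqnorm x], plus [c], in each
   step. Every intermediate exponent is a convex combination of [Q0] and [Q1], so it keeps their
   common lower bound. *)
pose n := (Num.bound (4 * `|K| / eta)).+1.
have nK : `|K| / n%:R <= eta / 4.
  have H : 4 * `|K| / eta < n%:R.
    apply: lt_trans (_ : _ < (Num.bound (4 * `|K| / eta))%:R) _.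
      by apply: archi_boundP; rewrite divr_ge0 ?mulr_ge0// ltW.
    by rewrite ltr_nat.
  rewrite ler_pdivrMr ?ltr0n//; move: H; rewrite ltr_pdivrMr// => H; lra.
pose Qs (k : nat) x := Q0 x + (k%:R / n%:R) * (Q1 x - Q0 x).
have HQs k : polyfun (Qs k).
  by apply: polyfunD => //; apply: polyfun_scale; exact: polyfunB.
have lbs k x : (k <= n)%N -> eta * sqnorm x - c <= Qs k x.
  move=> kn; have s0 : 0 <= (k%:R / n%:R : R) by rewrite divr_ge0.
  have s1 : (k%:R / n%:R : R) <= 1 by rewrite ler_pdivrMr ?ltr0n// mul1r ler_nat.
  rewrite /Qs; move: (lb0 x) (lb1 x); move: (eta * _ - c) (Q0 x) (Q1 x) => e a b ea eb.
  move: (_ / _) s0 s1 => s s0 s1; nra.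
suff HPs k : (k <= n)%N -> forall p, polyfun p ->
    approximable P (fun x => p x * expR (- Qs k x)).
  move=> p /(HPs n (leqnn n)); rewrite /Qs divff ?pnatr_eq0//.
  by under eq_fun do rewrite mul1r addrC subrK.
elim: k => [_ p Hp|k IH kn p Hp].
  by rewrite /Qs mul0r; under eq_fun do rewrite mul0r addr0; exact: HP.
have -> : (fun x => p x * expR (- Qs k.+1 x)) =
    fun x => p x * expR ((- n%:R^-1) * (Q1 x - Q0 x) - Qs k x).
  apply/funext => x; congr (_ * expR _); rewrite /Qs -natr1 mulrDl mul1r; ring.
(* The increment is at most (eta / 4) [sqnorm x] + c <= Q / 4 + 5 c / 4 for the current exponent Q;
   the constant 2 c leaves room for this. *)
apply: (@approximable_taylor _ _ eta (2 * c)) => //.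
- by apply: polyfun_scale; exact: polyfunB.
- move=> x; rewrite normrM normrN (ger0_norm (_ : 0 <= n%:R^-1)) ?invr_ge0//.
  have := lbs k x (ltnW kn).
  have : n%:R^-1 * `|Q1 x - Q0 x| <= eta / 4 * sqnorm x + c.
    apply: (@le_trans _ _ (n%:R^-1 * (`|K| * sqnorm x + c))).
      rewrite ler_wpM2l ?invr_ge0//; apply: le_trans (ub x) _.
      by rewrite lerD2r ler_wpM2r ?ler_norm ?sqnorm_ge0.
    rewrite mulrDr mulrA [_^-1 * _]mulrC; apply: lerD.
      by rewrite ler_wpM2r ?sqnorm_ge0.
    by rewrite ler_piMl// invf_le1 ?ltr0n// ler1n.
  move: (Qs k x) (sqnorm x) (_ * `|_|) => a b e leb lea; nra.
- by move=> x; have := lbs k x (ltnW kn); lra.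
- exact: IH (ltnW kn).
Qed.

End polynomial_gaussians.

(** * Sums over finite parts of a scaled integer lattice *)

Section lattice_sums.
Context {R : realType} {d : nat}.
Local Notation E := 'rV[R]_d.
Local Notation lattice := {ffun 'I_d -> int}.
Implicit Types (k l m : lattice) (s : R) (t : seq lattice).

Definition lpoint s k : E := \row_i ((k i)%:~R / s).

Lemma lpointB s k l : lpoint s k - lpoint s l = lpoint s (k - l).
Proof. by apply/rowP => i; rewrite !mxE !ffunE -mulrBl -intrB. Qed.

Definition box J : seq lattice :=
  [seq [ffun i => (f i)%:Z - J%:Z] | f : {ffun 'I_d -> 'I_J.*2.+1}].

Lemma box_uniq J : uniq (box J).
Proof.
rewrite map_inj_uniq ?enum_uniq// => f g /ffunP fg; apply/ffunP => i.
by have := fg i; rewrite !ffunE => /addIr[] /ord_inj.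
Qed.

Lemma mem_box J k : (k \in box J) = [forall i, `|k i|%N <= J]%N.
Proof.
apply/mapP/forallP => [[f _ ->] i|kJ].
  by rewrite ffunE; case: (f i) => j /= jJ; lia.
have H i : (`|(k i + J%:Z)%R|%N < J.*2.+1)%N by have := kJ i; lia.
exists [ffun i => Ordinal (H i)]; first by rewrite mem_enum.
apply/ffunP => i; rewrite !ffunE /=; have := kJ i; lia.
Qed.

Definition sum1 J (g : int -> R) : R := \sum_(j < J.*2.+1) g (j%:Z - J%:Z).

Lemma sum1S J g : sum1 J.+1 g = g (- (J.+1)%:Z) + sum1 J g + g (J.+1)%:Z.
Proof.
rewrite /sum1 doubleS big_ord_recl big_ord_recr /= addrA; congr (_ + _ + _).
- by rewrite sub0r.
- by apply: eq_bigr => j _; congr g; rewrite /bump /=; lia.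
- by congr g; rewrite /bump /=; lia.
Qed.

Lemma sum_box_prod J (g : int -> R) :
  \sum_(k <- box J) \prod_i g (k i) = sum1 J g ^+ d.
Proof.
rewrite /box big_map big_enum /=.
under eq_bigr do under eq_bigr do rewrite ffunE.
rewrite -(bigA_distr_bigA (fun (i : 'I_d) (j : 'I_J.*2.+1) => g (j%:Z - J%:Z))) /=.
by rewrite prodr_const card_ord.
Qed.

(* [1 / (1 + x)^2] is compared with the telescoping differences of
   [- s / (1 + x / s)]. *)
Lemma sum1_le J s : 1 <= s ->
  sum1 J (fun j => ((1 + `|j%:~R / s|) ^+ 2)^-1) <= 3 * s.
Proof.
move=> s1; have s0 : 0 < s by exact: lt_le_trans s1.
suff H : sum1 J (fun j => ((1 + `|j%:~R / s|) ^+ 2)^-1) <=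
    1 + 2 * s * (1 - (1 + J%:R / s)^-1).
  apply: le_trans H _; have : 0 <= (1 + J%:R / s)^-1.
    by rewrite invr_ge0 addr_ge0// divr_ge0// ltW.
  move: (_^-1) => b b0; nra.
elim: J => [|J IH].
  by rewrite /sum1 big_ord_recl big_ord0 subrr !mul0r normr0 !addr0 expr1n invr1
    subrr mulr0 addr0.
rewrite sum1S.
have E1 : `|(J.+1)%:Z%:~R / s| = J%:R / s + s^-1.
  by rewrite ger0_norm ?divr_ge0 ?(ltW s0)//= -[_%:~R]/(_%:R) -natr1 mulrDl mul1r.
rewrite mulrNz mulNr normrN E1.
have -> : J.+1%:R / s = J%:R / s + s^-1 by rewrite -natr1 mulrDl mul1r.
set a := J%:R / s in IH *; set b := s^-1.
have a0 : 0 <= a by rewrite divr_ge0// ltW.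
have b0 : 0 < b by rewrite invr_gt0.
have bs : b * s = 1 by rewrite mulVf// gt_eqF.
have step : ((1 + (a + b)) ^+ 2)^-1 <= s * ((1 + a)^-1 - (1 + (a + b))^-1).
  have -> : s * ((1 + a)^-1 - (1 + (a + b))^-1) = ((1 + a) * (1 + (a + b)))^-1.
    rewrite /b; field; rewrite !gt_eqF//=; [lra|nra].

  have p1 : 0 < (1 + (a + b)) ^+ 2 by rewrite exprn_gt0//; lra.
  have p2 : 0 < (1 + a) * (1 + (a + b)) by rewrite mulr_gt0//; lra.
  by rewrite lef_pV2 ?posrE//; nra.
move: step IH; move: (sum1 _ _) (_^-1) (_^-1) (_^-1) => ? ? ? ?; lra.
Qed.

Lemma weight_lpoint s k : (weight (lpoint s k) ^+ 2)^-1 =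
  \prod_i ((1 + `|(k i)%:~R / s|) ^+ 2)^-1.
Proof.
rewrite prodfV prodrXl; congr (_ ^+ 2)^-1.
by apply: eq_bigr => i _; rewrite mxE.
Qed.

Lemma ler_sum_uniq_sub (I : eqType) (t t' : seq I) (F : I -> R) :
  uniq t -> uniq t' -> {subset t <= t'} -> (forall i, 0 <= F i) ->
  \sum_(i <- t) F i <= \sum_(i <- t') F i.
Proof.
move=> ut ut' sub F0.
have tt' : perm_eq t [seq i <- t' | i \in t].
  apply: uniq_perm => //; first exact: filter_uniq.
  by move=> i; rewrite mem_filter andb_idr//; exact: sub.
by rewrite (perm_big _ tt') big_filter [leRHS](bigID (mem t)) /= lerDl sumr_ge0.
Qed.

(** A finite set of lattice points lies in some box, over which the sum is the d-th power of a
    one-dimensional sum bounded by 3 s. *)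
Lemma sum_weight_lpoint s t : 1 <= s -> uniq t ->
  \sum_(k <- t) (weight (lpoint s k) ^+ 2)^-1 <= (3 * s) ^+ d.
Proof.
move=> s1 ut; pose J := (\sum_(k <- t) \sum_i `|k i|)%N.
apply: (@le_trans _ _ (\sum_(k <- box J) (weight (lpoint s k) ^+ 2)^-1)).
  apply: ler_sum_uniq_sub => // [|k kt|k]; first exact: box_uniq.
    rewrite mem_box; apply/forallP => i.
    by rewrite /J (big_rem k kt) (bigD1 i)//= -addnA leq_addr.
  by rewrite invr_ge0 exprn_ge0// ltW// weight_gt0.
under eq_bigr do rewrite weight_lpoint.
rewrite (sum_box_prod J (fun j => ((1 + `|j%:~R / s|) ^+ 2)^-1)).
rewrite lerXn2r ?nnegrE ?sum1_le//; last by rewrite mulr_ge0// (le_trans ler01).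
by apply: sumr_ge0 => j _; rewrite invr_ge0 exprn_ge0 ?addr_ge0.
Qed.

(** The common terms cancel, and each of the two set differences contributes at most C. *)
Lemma sum_symdiff_le (I : eqType) (t t' : seq I) (F G : I -> R) (C : R) :
  uniq t -> uniq t' ->
  (forall i, (i \notin t) || (i \notin t') -> `|F i| <= G i) ->
  (forall r, uniq r -> \sum_(i <- r) G i <= C) ->
  `|\sum_(i <- t) F i - \sum_(i <- t') F i| <= 2 * C.
Proof.
move=> ut ut' FG GC.
rewrite (bigID (mem t')) [X in _ - X](bigID (mem t)) /=.
have -> : \sum_(i <- t | i \in t') F i = \sum_(i <- t' | i \in t) F i.
  rewrite -!(big_filter _ (fun i => i \in _)); apply: perm_big; apply: uniq_perm.
  - exact: filter_uniq.
  - exact: filter_uniq.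
  - by move=> i; rewrite !mem_filter andbC.
rewrite [X in X - _]addrC addrKA mulr_natl mulr2n; apply: le_trans (ler_normB _ _) _.
have H (r r' : seq I) : uniq r -> (forall i, i \notin r' -> `|F i| <= G i) ->
    `|\sum_(i <- r | i \notin r') F i| <= C.
  move=> ur FGr; apply: le_trans (ler_norm_sum _ _ _) _.
  apply: le_trans (GC [seq i <- r | i \notin r'] (filter_uniq _ ur)).
  by rewrite big_filter; apply: ler_sum => i; exact: FGr.
by apply: lerD; apply: H => // i it; apply: FG; rewrite it ?orbT.
Qed.

End lattice_sums.

(** * Discrete convolution of a Schwartz function with a Gaussian *)

Section discrete_convolution.
Context {R : realType} {d : nat}.
Local Notation E := 'rV[R]_d.
Local Notation dir i := (delta_mx 0 i : 'rV[R]_d).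
Local Notation lattice := {ffun 'I_d -> int}.
Implicit Types (n T m N : nat) (k l : lattice) (x y : E).

Definition gkernel T x : R := expR (- (T.+1%:R ^+ 2 * sqnorm x)).

Definition step n T : R := n.+1%:R * T.+1%:R.
(** The quadratic radius makes the nodes fill the cube of half-side (n+1) / (T+1): as [n] grows the
    mesh shrinks while the cube exhausts the space. *)
Definition grid n : seq lattice := box (n.+1 ^ 2).
Definition node n T k : E := lpoint (step n T) k.
(** This is the value of the kernel at a node ([gkernel_node]). It is independent of [T], so moment
    bounds for these weights are uniform in [T]. *)
Definition gweight n k : R := expR (- sqnorm (lpoint n.+1%:R k : E)).
Definition mass n : R := \sum_(k <- grid n) gweight n k.

Lemma gweight_gt0 n k : 0 < gweight n k.
Proof. exact: expR_gt0. Qed.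

Lemma step_ge n T : n.+1%:R <= step n T.
Proof. by rewrite /step ler_peMr// ler1n. Qed.

Lemma step_ge1 n T : 1 <= step n T.
Proof. by apply: le_trans (step_ge n T); rewrite ler1n. Qed.

Lemma nodeE n T k : node n T k = T.+1%:R^-1 *: lpoint n.+1%:R k.
Proof.
apply/rowP => i; rewrite !mxE /step; field.
by rewrite !nat1r !pnatr_eq0.
Qed.

Lemma gkernel_node n T k : gkernel T (node n T k) = gweight n k.
Proof.
rewrite /gkernel /gweight nodeE /sqnorm mulr_sumr; congr (expR (- _)).
apply: eq_bigr => i _; rewrite !mxE; field.
by rewrite !nat1r !pnatr_eq0.
Qed.

Lemma weight_node n T k : weight (node n T k) <= weight (lpoint n.+1%:R k).
Proof.
rewrite nodeE /weight; apply: ler_prod => i _; rewrite addr_ge0//= lerD2l.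
rewrite [in leLHS]mxE normrM ler_piMl// ger0_norm ?invr_ge0//.
by rewrite invf_le1 ?ltr0n// ler1n.
Qed.

(** The mass is the d-th power of a one-dimensional sum, in which every term with |j| <= n + 1 is at
    least 1 / e. *)
Lemma mass_ge n : (n.+1%:R * expR (-1)) ^+ d <= mass n.
Proof.
have -> : mass n = sum1 (n.+1 ^ 2) (fun j => expR (- (j%:~R / n.+1%:R) ^+ 2)) ^+ d.
  rewrite -sum_box_prod /mass /grid; apply: eq_bigr => k _.
  rewrite /gweight /sqnorm -sumrN expR_sum; apply: eq_bigr => i _.
  by rewrite mxE.
rewrite lerXn2r ?nnegrE ?mulr_ge0 ?expR_ge0//.
  by apply: sumr_ge0 => j _; exact: expR_ge0.
set g := fun j : int => _.
have mono J J' : sum1 J g <= sum1 (J' + J) g.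
  elim: J' => [//|J' IH]; rewrite addSn sum1S; apply: le_trans IH _.
  by rewrite -addrA addrCA lerDl addr_ge0// expR_ge0.
have nn : (n.+1 <= n.+1 ^ 2)%N by rewrite expnS expn1 leq_pmulr.
rewrite -(subnK nn); apply: le_trans (mono _ _).
apply: (@le_trans _ _ (\sum_(j < n.+1.*2.+1) expR (-1))).
  rewrite sumr_const card_ord -[leRHS]mulr_natl ler_wpM2r ?expR_ge0// ler_nat; lia.
apply: ler_sum => j _; rewrite ler_expR lerN2.
rewrite -(real_normK (num_real _)) expr_le1// normrM normfV.
rewrite [X in _ / X]ger0_norm// ler_pdivrMr ?ltr0n// mul1r.
rewrite -intr_norm -[n.+1%:R]/(n.+1%:Z%:~R) ler_int.
have := ltn_ord j; lia.
Qed.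

Lemma mass_gt0 n : 0 < mass n.
Proof. by apply: lt_le_trans (mass_ge n); rewrite exprn_gt0// mulr_gt0 ?expR_gt0. Qed.

(** The lattice sum grows at most like (3 (n+1) (T+1))^d and the mass at least like ((n+1) / e)^d,
    so the quotient is bounded uniformly in [n]. *)
Lemma mass_sum_bound n T t (F : lattice -> R) (C : R) : uniq t -> 0 <= C ->
  (forall k, F k <= C * (weight (node n T k) ^+ 2)^-1) ->
  (mass n)^-1 * \sum_(k <- t) F k <= C * (3 * T.+1%:R * expR 1) ^+ d.
Proof.
move=> ut C0 FC; rewrite ler_pdivrMl ?mass_gt0//.
apply: (@le_trans _ _ (C * (3 * step n T) ^+ d)).
  apply: le_trans (_ : C * \sum_(k <- t) (weight (node n T k) ^+ 2)^-1 <= _).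
    by rewrite mulr_sumr; apply: ler_sum => k _.
  by rewrite ler_wpM2l// sum_weight_lpoint// step_ge1.
rewrite [leRHS]mulrCA ler_wpM2l//.
have -> : (3 * step n T) ^+ d =
    (n.+1%:R * expR (-1)) ^+ d * (3 * T.+1%:R * expR 1) ^+ d.
  rewrite -exprMn; congr (_ ^+ d); rewrite /step expRN.
  by field; rewrite gt_eqF// expR_gt0.
rewrite ler_wpM2r ?mass_ge// exprn_ge0// !mulr_ge0 ?expR_ge0//.
Qed.

(** The Gaussian dominates [m + 2] powers of the weight, two of which make the lattice sum converge;
    [mass_sum_bound] is used with [T = 0]. *)
Lemma gweight_moment m : exists2 C : R, 0 <= C & forall n,
  (mass n)^-1 * \sum_(k <- grid n) gweight n k * weight (lpoint n.+1%:R k) ^+ m <= C.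
Proof.
have [C C0 HC] := @weight_gaussian R d (m + 2) 1 ltr01.
exists (C * (3 * 1%:R * expR 1) ^+ d) => [|n].
  by rewrite mulr_ge0// exprn_ge0// !mulr_ge0// expR_ge0.
apply: (@mass_sum_bound n 0) => // [|k]; first exact: box_uniq.
rewrite /node /step mulr1 ler_pdivlMr ?weightX_gt0//.
have := HC (lpoint n.+1%:R k); rewrite mul1r exprD mulrC.
by rewrite /gweight mulrA.
Qed.

Definition average n (F : lattice -> R) : R :=
  (mass n)^-1 * \sum_(k <- grid n) gweight n k * F k.

Lemma average_cst n (a : R) : average n (fun=> a) = a.
Proof. by rewrite /average -mulr_suml mulrA mulVf ?mul1r// gt_eqF// mass_gt0. Qed.

Lemma averageB n F G :
  average n F - average n G = average n (fun k => F k - G k).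
Proof.
rewrite /average -mulrBr -sumrB; congr (_ * _); apply: eq_bigr => k _.
by rewrite mulrBr.
Qed.

Lemma average_le n m (F : lattice -> R) (C D : R) : 0 <= C ->
  (mass n)^-1 * \sum_(k <- grid n) gweight n k * weight (lpoint n.+1%:R k) ^+ m <= D ->
  (forall k, `|F k| <= C * weight (lpoint n.+1%:R k) ^+ m) ->
  `|average n F| <= C * D.
Proof.
move=> C0 HD HF; apply: le_trans (ler_wpM2l C0 HD).
have M0 : 0 <= (mass n)^-1 by rewrite invr_ge0 ltW// mass_gt0.
rewrite /average normrM (ger0_norm M0) mulrCA ler_wpM2l//.
apply: le_trans (ler_norm_sum _ _ _) _; rewrite mulr_sumr.
apply: ler_sum => k _; rewrite normrM (gtr0_norm (gweight_gt0 _ _)) mulrCA.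
by rewrite ler_wpM2l// ltW// gweight_gt0.
Qed.

Section schwartz_function.
Variable f : E -> R.
Hypothesis f_bounded : bounded_family (fun _ : unit => f).

Let sf : smooth f := f_bounded.1 tt.

(** Both this and [gaussconv] are Riemann sums for the convolution of [f] with a normalized
    Gaussian: here [f] is translated, there the kernel. *)
Definition avgconv n T x : R := average n (fun k => f (x - node n T k)).

Definition gaussconv n T x : R := (mass n)^-1 *
  \sum_(k <- grid n) f (node n T k) * gkernel T (x - node n T k).

Let schwartz_bound m s : sorted (fun i j : 'I_d => (i <= j)%N) s ->
  exists2 C : R, 0 <= C & forall x, weight x ^+ m * `|ipartial s f x| <= C.
Proof.
move=> ss; have [C HC] := f_bounded.2 m (size s).
have {}HC x := HC tt s x ss (leqnn _).
by exists C => //; apply: le_trans (HC 0); rewrite mulr_ge0// ltW// weightX_gt0.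
Qed.

Lemma weight_translate_le (g : E -> R) m (C : R) : 0 <= C ->
  (forall x, weight x ^+ m * `|g x| <= C) ->
  forall x y, weight x ^+ m * `|g (x - y)| <= C * weight y ^+ m.
Proof.
move=> C0 HC x y.
have wxy : weight x ^+ m <= weight (x - y) ^+ m * weight y ^+ m.
  rewrite -exprMn lerXn2r ?nnegrE ?mulr_ge0 ?(ltW (weight_gt0 _))//.
  by rewrite -{1}(subrK y x) weightD.
apply: le_trans (ler_wpM2r (normr_ge0 _) wxy) _.
by rewrite mulrAC ler_wpM2r// ltW// weightX_gt0.
Qed.

Lemma avgconv_smooth n T : smooth (avgconv n T).
Proof.
apply: smoothZ; apply: smooth_sum => k; apply: smoothZ; exact: smooth_translate.
Qed.

Lemma ipartial_avgconv n T s x : ipartial s (avgconv n T) x =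
  average n (fun k => ipartial s f (x - node n T k)).
Proof.
have sk k := smooth_translate (node n T k) sf.
have sF k := smoothZ (gweight n k) (sk k).
rewrite /avgconv /average (ipartialZ _ _ (smooth_sum (grid n) sF)).
rewrite (ipartial_sum _ _ sF); congr (_ * _); apply: eq_bigr => k _.
by rewrite (ipartialZ _ _ (sk k)) ipartial_translate.
Qed.

(** Translating by a node costs a power of its weight, which is at most its value for [T = 0]; the
    moments of [gweight] absorb it uniformly in [n] and [T]. *)
Lemma avgconv_bounded_family :
  bounded_family (fun i : nat * nat => avgconv i.1 i.2).
Proof.
apply: bounded_familyP => [i|m s ss]; first exact: avgconv_smooth.
have [C C0 HC] := schwartz_bound m ss; have [D D0 HD] := gweight_moment m.
exists (C * D) => -[n T] x; rewrite ipartial_avgconv.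
rewrite -{1}(ger0_norm (ltW (weightX_gt0 x m))) -normrM.
have -> : weight x ^+ m * average n (fun k => ipartial s f (x - node n T k)) =
    average n (fun k => weight x ^+ m * ipartial s f (x - node n T k)).
  rewrite /average mulrCA mulr_sumr; congr (_ * _).
  by apply: eq_bigr => k _; rewrite mulrCA.
apply: (average_le C0 (HD n)) => k; rewrite normrM (ger0_norm (ltW (weightX_gt0 x m))).
apply: le_trans (weight_translate_le C0 HC _ _) _.
rewrite ler_wpM2l// lerXn2r ?nnegrE ?(ltW (weight_gt0 _))//.
exact: weight_node.
Qed.

(** [f] is Lipschitz and the nodes carry a factor 1 / (T+1), so the error is a Lipschitz constant
    times the first moment of the weights, divided by T + 1. *)
Lemma avgconv_cvg : exists2 C : R, 0 <= C & forall n T x,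
  `|f x - avgconv n T x| <= C / T.+1%:R.
Proof.
have [C HC] := f_bounded.2 0%N 1%N; have [D D0 HD] := gweight_moment 1.
have lip x y : `|f (x + y) - f x| <= `|C| * \sum_i `|y 0 i|.
  apply: (@lipschitz_coord _ _ _ (fun i => ipartial [:: i] f)) => i z.
    exact: (smooth_is_derive [::]).
  have := HC tt [:: i] z isT isT; rewrite expr0 mul1r => /le_trans; apply.
  exact: ler_norm.
exists (`|C| * D) => [|n T x]; first exact: mulr_ge0.
rewrite -(average_cst n (f x)) averageB mulrAC.
apply: (average_le _ (HD n)) => [|k]; first by rewrite divr_ge0.
rewrite distrC expr1; apply: le_trans (lip _ _) _.
rewrite -mulrA ler_wpM2l// nodeE.
apply: le_trans (_ : T.+1%:R^-1 * \sum_i `|(lpoint n.+1%:R k : E) 0 i| <= _).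
  rewrite mulr_sumr; apply: ler_sum => i _.
  by rewrite 2![in leLHS]mxE normrN normrM ger0_norm// invr_ge0.
by rewrite ler_wpM2l ?invr_ge0// sum_norm_le_weight.
Qed.

Lemma sqnorm_polyfun : polyfun (@sqnorm R d).
Proof. by apply: polyfun_sum => i; apply: polyfunX; exact: polyfun_coord. Qed.

Lemma gkernel_bounded_family T : bounded_family (fun _ : unit => gkernel T).
Proof.
have T0 : 0 < T.+1%:R ^+ 2 :> R by rewrite exprn_gt0.
have HQ := polyfun_scale (T.+1%:R ^+ 2) sqnorm_polyfun.
have := poly_gaussian_bounded_family T0 (lexx 0) (polyfun_cst 1) HQ.
have -> : (fun (_ : unit) (x : E) => 1 * expR (- (T.+1%:R ^+ 2 * sqnorm x))) =
    fun=> gkernel T.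
  by apply/funext => _; apply/funext => x; rewrite mul1r.
by apply => x; rewrite subr0.
Qed.

Lemma gaussconv_smooth n T : smooth (gaussconv n T).
Proof.
apply: smoothZ; apply: smooth_sum => k; apply: smoothZ; apply: smooth_translate.
exact: (gkernel_bounded_family T).1 tt.
Qed.

(** The weight at [x] moves to the node at the cost of the decay of the kernel. The decay of [f] to
    order [m + 2] pays for it and leaves a summable w^-2. *)
Lemma gaussconv_bounded_family T : bounded_family (fun n => gaussconv n T).
Proof.
have sG := (gkernel_bounded_family T).1 tt.
have sk n k := smooth_translate (node n T k) sG.
apply: bounded_familyP => [i|m s ss]; first exact: gaussconv_smooth.
have [D HD] := (gkernel_bounded_family T).2 m (size s).
have {}HD x := HD tt s x ss (leqnn _).
have D0 : 0 <= D by apply: le_trans (HD 0); rewrite mulr_ge0// ltW// weightX_gt0.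
have [C C0 HC] := @schwartz_bound (m + 2) [::] isT.
exists (C * D * (3 * T.+1%:R * expR 1) ^+ d) => n x.
have sF k := smoothZ (f (node n T k)) (sk n k).
rewrite /gaussconv (ipartialZ _ _ (smooth_sum (grid n) sF)) (ipartial_sum _ _ sF).
have M0 : 0 <= (mass n)^-1 by rewrite invr_ge0 ltW// mass_gt0.
rewrite normrM (ger0_norm M0) mulrCA.
apply: (@le_trans _ _ ((mass n)^-1 * \sum_(k <- grid n) weight x ^+ m *
    `|f (node n T k) * ipartial s (gkernel T) (x - node n T k)|)).
  rewrite ler_wpM2l// -mulr_sumr ler_wpM2l ?(ltW (weightX_gt0 _ _))//.
  apply: le_trans (ler_norm_sum _ _ _) _; apply: ler_sum => k _.
  by rewrite (ipartialZ _ _ (sk n k)) ipartial_translate.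
apply: mass_sum_bound => [||k]; [exact: box_uniq|exact: mulr_ge0|].
rewrite normrM mulrCA.
apply: le_trans (ler_wpM2l (normr_ge0 _) (weight_translate_le D0 HD _ _)) _.
rewrite ler_pdivlMr ?weightX_gt0// -mulrA -mulrA -exprD.
rewrite mulrCA [leRHS]mulrC ler_wpM2l// mulrC.
exact: HC.
Qed.

Lemma convB_bounded_family T :
  bounded_family (fun n x => avgconv n T x - gaussconv n T x).
Proof.
apply: bounded_familyB; last exact: gaussconv_bounded_family.
have [sc bc] := avgconv_bounded_family; split=> [n|m N]; first exact: sc (n, T).
by have [C HC] := bc m N; exists C => n; exact: HC (n, T).
Qed.

(* At a grid point, both convolutions are sums of the same function over two
   boxes which are mirror images of each other. *)
Lemma conv_eq_on_nodes T : exists2 C : R, 0 <= C & forall n l,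
  `|avgconv n T (node n T l) - gaussconv n T (node n T l)| <= C / n.+1%:R.
Proof.
have [C C0 HC] := @schwartz_bound 3 [::] isT.
have [D HD] := (gkernel_bounded_family T).2 1%N 0%N.
have {}HD x := HD tt [::] x isT isT.
have D0 : 0 <= D by apply: le_trans (HD 0); rewrite mulr_ge0// ltW// weightX_gt0.
pose a := (3 * T.+1%:R * expR 1) ^+ d : R.
have a0 : 0 <= a by rewrite exprn_ge0// !mulr_ge0// expR_ge0.
exists (2 * (C * D * T.+1%:R * a)) => [|n l]; first by rewrite !mulr_ge0.
pose Phi k := f (node n T k) * gkernel T (node n T (l - k)).
have -> : gaussconv n T (node n T l) = (mass n)^-1 * \sum_(k <- grid n) Phi k.
  by congr (_ * _); apply: eq_bigr => k _; rewrite /node lpointB.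
pose mirror := [seq l - k | k <- grid n].
have -> : avgconv n T (node n T l) = (mass n)^-1 * \sum_(k <- mirror) Phi k.
  congr (_ * _); rewrite [RHS]big_map; apply: eq_bigr => k _.
  by rewrite /Phi subKr /node lpointB gkernel_node mulrC.
have um : uniq mirror.
  by rewrite map_inj_uniq ?box_uniq// => k k' /addrI/oppr_inj.
have M0 : 0 <= (mass n)^-1 by rewrite invr_ge0 ltW// mass_gt0.
rewrite -mulrBr.
have far k : k \notin grid n -> n.+1%:R / T.+1%:R <= weight (node n T k).
  rewrite mem_box negb_forall => /existsP[i ki].
  rewrite -ltnNge in ki.
  apply: le_trans (norm_coord_le_weight _ i); rewrite mxE.
  apply: le_trans (_ : `|(k i)%:~R / step n T| <= _); last by rewrite lerDr.
  rewrite normrM normfV (ger0_norm (le_trans ler01 (step_ge1 n T))).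
  rewrite ler_pdivlMr ?(lt_le_trans ltr01 (step_ge1 n T))//.
  have -> : n.+1%:R / T.+1%:R * step n T = (n.+1 ^ 2)%:R.
    by rewrite natrX /step; field; rewrite nat1r pnatr_eq0.
  rewrite -intr_norm -[(n.+1 ^ 2)%:R]/((n.+1 ^ 2)%:Z%:~R) ler_int.
  by move: (n.+1 ^ 2)%N ki => j; lia.
have memm k : (k \in mirror) = (l - k \in grid n).
  apply/mapP/idP => [[k' k'g ->]|kg]; first by rewrite subKr.
  by exists (l - k) => //; rewrite subKr.
(* With w and w' the weights at the nodes of k and l - k, |Phi k| <= C D / (w^3 w'). If either node
   leaves the grid, then w w' >= (n+1) / (T+1); trading one such factor yields 1 / (n+1) and keeps
   the summable w^-2. *)
pose G k := C * D * T.+1%:R / n.+1%:R * (weight (node n T k) ^+ 2)^-1.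
have bPhi k : (k \notin mirror) || (k \notin grid n) -> `|Phi k| <= G k.
  set w := weight (node n T k); set w' := weight (node n T (l - k)).
  have [w1 w'1] : 1 <= w /\ 1 <= w' by split; exact: weight_ge1.
  have w0 : 0 < w by lra.
  have w'0 : 0 < w' by lra.
  have HP : w ^+ 3 * w' * `|Phi k| <= C * D.
    rewrite /Phi normrM mulrACA; apply: ler_pM.
    - by rewrite mulr_ge0// exprn_ge0// ltW.
    - by rewrite mulr_ge0// ltW.
    - exact: HC.
    - by have := HD (node n T (l - k)); rewrite expr1.
  move=> out; have far' : n.+1%:R / T.+1%:R <= w * w'.
    case/orP: out => [|/far kf].
      rewrite memm => /far kf; apply: le_trans kf _; rewrite -/w'.
      by rewrite ler_peMl// ltW.
    by apply: le_trans kf _; rewrite -/w ler_peMr// ltW.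
  rewrite /G -/w ler_pdivlMr ?exprn_gt0// ler_pdivlMr// mulrAC.
  have nT : n.+1%:R <= w * w' * T.+1%:R by rewrite -ler_pdivrMr.
  apply: (@le_trans _ _ (`|Phi k| * (w * w' * T.+1%:R) * w ^+ 2)).
    by rewrite ler_wpM2r ?exprn_ge0 ?ler_wpM2l// ltW.
  have -> : `|Phi k| * (w * w' * T.+1%:R) * w ^+ 2 =
      w ^+ 3 * w' * `|Phi k| * T.+1%:R by ring.
  by rewrite ler_wpM2r.
have Gsum r : uniq r -> (mass n)^-1 * \sum_(k <- r) G k <=
    C * D * T.+1%:R * a / n.+1%:R.
  move=> ur; rewrite mulrAC; apply: mass_sum_bound => //.
  by rewrite !mulr_ge0 ?invr_ge0.
rewrite normrM (ger0_norm M0) -ler_pdivlMl ?invr_gt0 ?mass_gt0// invrK.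
rewrite (_ : mass n * _ = 2 * (mass n * (C * D * T.+1%:R * a / n.+1%:R))); last by ring.
apply: (sum_symdiff_le um (box_uniq _) bPhi) => r ur.
by rewrite -ler_pdivrMl ?mass_gt0// Gsum.
Qed.

Lemma near_node n T x : exists l, forall i,
  `|x 0 i - node n T l 0 i| <= n.+1%:R^-1.
Proof.
have s0 : 0 < step n T by exact: lt_le_trans (step_ge1 n T).
exists [ffun i => Num.floor (x 0 i * step n T)] => i.
rewrite mxE ffunE.
apply: le_trans (_ : (step n T)^-1 <= _); last first.
  by rewrite lef_pV2 ?posrE// step_ge.
have -> : x 0 i - (Num.floor (x 0 i * step n T))%:~R / step n T =
   (x 0 i * step n T - (Num.floor (x 0 i * step n T))%:~R) / step n T.
  by rewrite mulrBl mulfK// gt_eqF.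
rewrite normrM normfV (gtr0_norm s0) ler_piMl ?invr_ge0 ?(ltW s0)//.
have /andP[f1 f2] := floor_itv (x 0 i * step n T).
move: f2; rewrite intrD -ltrBlDl => /ltW.
by rewrite ger0_norm ?subr_ge0.
Qed.

(** The difference is O(1 / (n+1)) at all nodes and Lipschitz uniformly in [n], and every point is
    within 1 / (n+1) of a node in each coordinate. *)
Lemma conv_cvg T (eps : R) : 0 < eps ->
  exists n, forall x, `|avgconv n T x - gaussconv n T x| <= eps.
Proof.
move=> e0; have [sB bB] := convB_bounded_family T.
have [C HC] := bB 0%N 1%N; have [D D0 HD] := conv_eq_on_nodes T.
have lip n x y : `|(avgconv n T (x + y) - gaussconv n T (x + y)) -
    (avgconv n T x - gaussconv n T x)| <= `|C| * \sum_i `|y 0 i|.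
  apply: (@lipschitz_coord _ _ (fun z => avgconv n T z - gaussconv n T z)
    (fun i => ipartial [:: i] _)) => i z.
    exact: (smooth_is_derive [::] _ _ (sB n)).
  have := HC n [:: i] z isT isT; rewrite expr0 mul1r => /le_trans; apply.
  exact: ler_norm.
pose K := D + `|C| * d%:R.
have K0 : 0 <= K by rewrite addr_ge0// mulr_ge0.
have Kn : K / (Num.bound (K / eps)).+1%:R <= eps.
  rewrite ler_pdivrMr ?ltr0n// mulrC -ler_pdivrMr//.
  apply: le_trans (ltW (archi_boundP _)) _; first by rewrite divr_ge0// ltW.
  by rewrite ler_nat.
exists (Num.bound (K / eps)) => x; apply: le_trans Kn.
move: (Num.bound _) => n; have [l Hl] := near_node n T x.
have := lip n (node n T l) (x - node n T l); rewrite subrKC => H.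
rewrite -(subrK (avgconv n T (node n T l) - gaussconv n T (node n T l))
  (avgconv n T x - gaussconv n T x)).
apply: le_trans (ler_normD _ _) _; rewrite addrC /K mulrDl.
apply: lerD; first exact: HD.
apply: le_trans H _; rewrite -mulrA ler_wpM2l//.
apply: (@le_trans _ _ (\sum_(i < d) n.+1%:R^-1)).
  by apply: ler_sum => i _; rewrite !mxE; have := Hl i; rewrite !mxE.
by rewrite sumr_const card_ord mulr_natl.
Qed.

(** The order of choices matters: [T] is fixed first, with an error uniform in [n], and only then
    [n], since the comparison of the two sums depends on [T]. *)
Lemma approximable_schwartz (P : set (E -> R)) : P (fun=> 0) ->
  (forall p q b, P p -> P q -> P (fun x => p x + b * q x)) ->
  (forall T y, approximable P (fun x => gkernel T (x - y))) ->
  approximable P f.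
Proof.
move=> P0 Plin PG.
apply: (@approximable_trans _ _ _ [set g | exists n T, g = gaussconv n T]).
  move=> _ [n [T ->]].
  have -> : gaussconv n T = fun x => \sum_(k <- grid n)
      ((mass n)^-1 * f (node n T k)) * gkernel T (x - node n T k).
    apply/funext => x; rewrite /gaussconv mulr_sumr.
    by apply: eq_bigr => k _; rewrite mulrA.
  exact: approximable_sum.
split=> // m N eps e0; have e20 : 0 < eps / 2 by rewrite divr_gt0.
have bB : bounded_family (fun (i : nat * nat) x => f x - avgconv i.1 i.2 x).
  apply: bounded_familyB avgconv_bounded_family; split=> // m' N'.
  by have [C HC] := f_bounded.2 m' N'; exists C => _; exact: HC tt.
have [delta delta0 Hd] := bounded_family_interpolation m N bB e20.
have [C C0 HC] := avgconv_cvg.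
pose T := Num.bound (C / delta).
have HT n x : `|f x - avgconv n T x| <= delta.
  apply: le_trans (HC n T x) _; rewrite ler_pdivrMr ?ltr0n// mulrC -ler_pdivrMr//.
  apply: le_trans (ltW (archi_boundP _)) _; first by rewrite divr_ge0// ltW.
  by rewrite ler_nat.
have [delta' delta'0 Hd'] :=
  bounded_family_interpolation m N (convB_bounded_family T) e20.
have [n Hn] := conv_cvg T delta'0.
exists (gaussconv n T); split; [by exists n, T|exact: gaussconv_smooth|].
have -> : (fun x => f x - gaussconv n T x) =
    fun x => (f x - avgconv n T x) + (avgconv n T x - gaussconv n T x).
  by apply/funext => x; rewrite addrA subrK.
rewrite (splitr eps); apply: sboundD.
- exact: smoothB sf (avgconv_smooth n T).
- by apply: smoothB; [exact: avgconv_smooth|exact: gaussconv_smooth].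
- by apply: (Hd (n, T)) => x; exact: HT.
- exact: Hd'.
Qed.

End schwartz_function.

End discrete_convolution.

(** * Coercivity and growth of quadratic forms *)

Section quadratic_forms.
Context {R : realType} {d : nat}.
Local Notation E := 'rV[R]_d.
Implicit Types (A : 'M[R]_d) (x y : E).

Definition qform A x : R := (x *m A *m x^T) 0 0.

Lemma qformE A x : qform A x = \sum_j \sum_k A k j * (x 0 k * x 0 j).
Proof.
rewrite /qform mxE; apply: eq_bigr => j _; rewrite !mxE mulr_suml.
by apply: eq_bigr => k _; ring.
Qed.

Lemma qform_polyfun A : polyfun (qform A).
Proof.
rewrite (_ : qform A = fun x => \sum_j \sum_k A k j * (x 0 k * x 0 j)).
  apply: polyfun_sum => j; apply: polyfun_sum => k; apply: polyfun_scale.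
  by apply: polyfunM; exact: polyfun_coord.
by apply/funext => x; exact: qformE.
Qed.

Lemma sqr_coord_le x i : x 0 i ^+ 2 <= sqnorm x.
Proof. by rewrite /sqnorm (bigD1 i)//= lerDl sumr_ge0// => j _; exact: sqr_ge0. Qed.

Lemma qform_ub A : exists2 K : R, 0 <= K & forall x, `|qform A x| <= K * sqnorm x.
Proof.
exists (\sum_j \sum_k `|A k j|) => [|x].
  by apply: sumr_ge0 => j _; exact: sumr_ge0.
rewrite qformE mulr_suml; apply: le_trans (ler_norm_sum _ _ _) _.
apply: ler_sum => j _; rewrite mulr_suml; apply: le_trans (ler_norm_sum _ _ _) _.
apply: ler_sum => k _; rewrite normrM ler_wpM2l//.
have := sqr_coord_le x k; have := sqr_coord_le x j.
rewrite -(real_normK (num_real (x 0 k))) -(real_normK (num_real (x 0 j))) normrM.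
have := sqr_ge0 (`|x 0 k| - `|x 0 j|); nra.
Qed.

Lemma qform_scale A (a : R) x : qform A (a *: x) = a ^+ 2 * qform A x.
Proof.
rewrite !qformE mulr_sumr; apply: eq_bigr => j _; rewrite mulr_sumr.
by apply: eq_bigr => k _; rewrite !mxE; ring.
Qed.

Lemma sqnorm_scale (a : R) x : sqnorm (a *: x) = a ^+ 2 * sqnorm x.
Proof.
by rewrite /sqnorm mulr_sumr; apply: eq_bigr => j _; rewrite mxE exprMn.
Qed.

Lemma sqnorm_gt0 x : x != 0 -> 0 < sqnorm x.
Proof.
move=> x0; rewrite lt_def sqnorm_ge0 andbT; apply: contra x0 => /eqP r0.
apply/eqP/rowP => i; rewrite mxE; apply/eqP; rewrite -sqrf_eq0 eq_le sqr_ge0 andbT.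
by rewrite -r0 sqr_coord_le.
Qed.

(** The form attains its minimum on the compact unit sphere, which is nonempty because d > 0; the
    minimum is positive and homogeneity extends the bound to all of space. *)
Lemma qform_lb A : (0 < d)%N -> posdef A ->
  exists2 eta : R, 0 < eta & forall x, eta * sqnorm x <= qform A x.
Proof.
move=> d_gt0 A_posdef; pose S := [set x : E | sqnorm x = 1].
have S0 : S !=set0.
  exists (delta_mx 0 (Ordinal d_gt0)).
  rewrite /S /= /sqnorm (bigD1 (Ordinal d_gt0))//= mxE !eqxx expr1n big1 ?addr0//.
  by move=> i /negbTE ni; rewrite mxE ni andbF expr0n.
have cS : compact S.
  apply: bounded_closed_compact.
    exists 1; split=> // M M1 x Sx; apply: le_trans (ltW M1).
    rewrite -[`|x|]/(mx_norm x) mx_normrE; apply: bigmax_le => // -[i j] _ /=.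
    rewrite -(@expr_le1 _ 2)// real_normK ?num_real// -Sx.
    by rewrite (ord1 i) sqr_coord_le.
  apply: (@closed_comp _ _ (@sqnorm R d) [set 1]); last exact: closed_eq.
  by move=> x _; exact: (polyfun_continuous sqnorm_polyfun).
have [|u uS Hu] := EVT_min_rV (f := qform A) S0 cS.
  by apply: continuous_subspaceT; exact: (polyfun_continuous (qform_polyfun A)).
have u1 : sqnorm u = 1 by move: uS; rewrite inE.
exists (qform A u).
  apply: A_posdef; apply/negP => /eqP u0.
  have : sqnorm u = 0 by rewrite u0; apply: big1 => i _; rewrite mxE expr0n.
  by move/eqP; rewrite u1 oner_eq0.
move=> x; have [->|x0] := eqVneq x 0.
  rewrite -(scale0r u) sqnorm_scale qform_scale expr0n /=.
  by rewrite !mul0r mulr0.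
have r0 := sqnorm_gt0 x0; pose a := (Num.sqrt (sqnorm x))^-1.
have a2 : a ^+ 2 = (sqnorm x)^-1 by rewrite /a exprVn sqr_sqrtr// ltW.
have := Hu (a *: x); rewrite inE /S /= sqnorm_scale a2 mulVf ?gt_eqF// => /(_ erefl).
by rewrite qform_scale a2 [_^-1 * _]mulrC ler_pdivlMr.
Qed.

Lemma sqnormB_lb x y : 1 / 2 * sqnorm x - sqnorm y <= sqnorm (x - y).
Proof.
rewrite /sqnorm mulr_sumr -sumrB; apply: ler_sum => i _; rewrite !mxE.
by have := sqr_ge0 (x 0 i - 2 * y 0 i); nra.
Qed.

Lemma sqnormB_ub x y : sqnorm (x - y) <= 2 * sqnorm x + 2 * sqnorm y.
Proof.
rewrite /sqnorm !mulr_sumr -big_split; apply: ler_sum => i _; rewrite !mxE /=.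
by have := sqr_ge0 (x 0 i + y 0 i); nra.
Qed.

End quadratic_forms.

(** * Density of polynomials times the given Gaussian, for real functions *)

Section gaussian_polynomials.
Context {R : realType} {d : nat}.
Local Notation E := 'rV[R]_d.
Variables (A : 'M[R]_d) (c : R).
Hypotheses (d_gt0 : (0 < d)%N) (A_posdef : posdef A) (c_gt0 : 0 < c).

Definition gaussian_polys : set (E -> R) :=
  [set g | exists2 p, polyfun p & g = fun x => p x * gaussian A c x].

Lemma gaussian_polys_bounded_family p : polyfun p ->
  bounded_family (fun (_ : unit) x => p x * gaussian A c x).
Proof.
move=> Hp; have [eta eta0 lb] := qform_lb d_gt0 A_posdef.
have := poly_gaussian_bounded_family (divr_gt0 eta0 (ltr0Sn _ 1)) (lexx 0)
  (polyfun_scale c Hp) (polyfun_scale (1 / 2) (qform_polyfun A)).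
have -> : (fun (_ : unit) (x : E) => c * p x * expR (- (1 / 2 * qform A x))) =
    fun _ x => p x * gaussian A c x.
  apply/funext => _; apply/funext => x.
  by rewrite /gaussian mulNr -/(qform A x) mulrCA mulrA.
by apply => x; have := lb x; lra.
Qed.

Lemma approximable_gkernel T (y : E) :
  approximable gaussian_polys (fun x => gkernel T (x - y)).
Proof.
have [eta eta0 lb] := qform_lb d_gt0 A_posdef.
have [K K0 ub] := qform_ub A.
pose t : R := T.+1%:R ^+ 2.
have t1 : 1 <= t by rewrite exprn_ege1// ler1n.
have y0 := sqnorm_ge0 y.
have HQ1 : polyfun (fun x => t * sqnorm (x - y)).
  apply: polyfun_scale; apply: polyfun_sum => i; apply: polyfunX.
  under eq_fun do rewrite !mxE.
  by apply: polyfunD; [exact: polyfun_coord|exact: polyfun_cst].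
have -> : (fun x => gkernel T (x - y)) =
    fun x => 1 * expR (- (t * sqnorm (x - y))).
  by apply/funext => x; rewrite mul1r.
(* The minimum is a coercivity constant common to both exponents, using t >= 1 for the second.
   [K + 2 * t] bounds the quadratic growth of their difference, and [2 * t * sqnorm y] absorbs the
   shift by [y]. *)
apply: (@approximable_gaussian _ _ _ (fun x => 1 / 2 * qform A x) _
    (Num.min (eta / 2) (1 / 2)) (K + 2 * t) (2 * t * sqnorm y)).
- by rewrite lt_min !divr_gt0.
- exact: polyfun_scale (qform_polyfun A).
- exact: HQ1.
- move=> x; have r0 := sqnorm_ge0 x.
  have : Num.min (eta / 2) (1 / 2) * sqnorm x <= eta / 2 * sqnorm x.
    by rewrite ler_wpM2r// ge_min lexx.
  have := lb x; move: (Num.min _ _ * _) => b; nra.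
- move=> x; have r0 := sqnorm_ge0 x.
  have : Num.min (eta / 2) (1 / 2) * sqnorm x <= 1 / 2 * sqnorm x.
    by rewrite ler_wpM2r// ge_min lexx orbT.
  have := sqnormB_lb x y; move: (Num.min _ _ * _) => b; nra.
- move=> x; have r0 := sqnorm_ge0 x.
  apply: le_trans (ler_normB _ _) _.
  rewrite (normrM t) (normrM (1 / 2)) (ger0_norm (le_trans ler01 t1)) (ger0_norm (sqnorm_ge0 _)).
  rewrite (ger0_norm (_ : 0 <= 1 / 2)) ?divr_ge0//.
  have := ub x; have := sqnormB_ub x y; nra.
(* The factor [c] of the Gaussian is divided out in the polynomial. *)
- move=> p Hp; have cp : polyfun (fun x => c^-1 * p x) by exact: polyfun_scale.
  have -> : (fun x => p x * expR (- (1 / 2 * qform A x))) =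
      fun x => (c^-1 * p x) * gaussian A c x.
    apply/funext => x; rewrite /gaussian mulNr -/(qform A x).
    by field; rewrite gt_eqF.
  apply: approximable_sub; last by exists (fun x => c^-1 * p x).
  exact: (gaussian_polys_bounded_family cp).1 tt.
- exact: polyfun_cst.
Qed.

Lemma approximable_gaussian_polys (f : E -> R) :
  bounded_family (fun _ : unit => f) -> approximable gaussian_polys f.
Proof.
move=> bf; apply: approximable_schwartz => //.
- exists (fun=> 0); first exact: polyfun_cst.
  by apply/funext => x; rewrite mul0r.
- move=> _ _ b [p Hp ->] [q Hq ->]; exists (fun x => p x + b * q x).
    by apply: polyfunD => //; exact: polyfun_scale.
  by apply/funext => x; rewrite mulrDl mulrA.
- exact: approximable_gkernel.
Qed.

End gaussian_polynomials.

(** * Passage between weighted real bounds and complex Schwartz seminorms *)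

Section schwartz_transfer.
Context {R : realType} {d : nat}.
Local Notation E := 'rV[R]_d.
Local Notation normc := ComplexField.Normc.normc.
Implicit Types (f : E -> R[i]^o) (g : E -> R) (alpha beta : multiindex d) (x : E).

Local Notation nondecr := (sorted (fun i j : 'I_d => (i <= j)%N)).

Definition directions beta : seq 'I_d :=
  flatten [seq nseq (beta i) i | i <- enum 'I_d].

Lemma directions_sorted beta : nondecr (directions beta).
Proof.
rewrite /directions; have : nondecr (enum 'I_d).
  have := iota_sorted 0 d; rewrite -val_enum_ord sorted_map.
  by apply: sub_sorted.
elim: (enum 'I_d) => [//|i s IH] /= pis.
have tr : transitive (fun i j : 'I_d => (i <= j)%N) by move=> a b c; exact: leq_trans.
have /andP[/allP ile ss] : all (fun j : 'I_d => (i <= j)%N) s && nondecr s.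
  by move: pis; rewrite path_sortedE.
have {}IH := IH ss.
have ile' j : j \in flatten [seq nseq (beta i) i | i <- s] -> (i <= j)%N.
  move=> /flattenP[r /mapP[k ks ->]] /nseqP[-> _]; exact: ile.
elim: (beta i) => [//|b IHb] /=.
rewrite path_sortedE// IHb andbT; apply/allP => j; rewrite mem_cat => /orP[|/ile'//].
by move=> /nseqP[->].
Qed.

Lemma count_mem_directions beta i : count_mem i (directions beta) = beta i.
Proof.
rewrite /directions count_flatten -map_comp sumnE big_map big_enum /=.
rewrite (bigD1 i)//= count_nseq /= eqxx mul1n big1 ?addn0// => j /negbTE ji.
by rewrite count_nseq /= ji.
Qed.

(** A nondecreasing list is determined by its multiplicities. Hence [sbound] and the seminorms range
    over the same derivatives. *)
Lemma sorted_directions (s : seq 'I_d) : nondecr s ->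
  s = directions [ffun i => count_mem i s].
Proof.
move=> ss; apply: (@sorted_eq _ (fun i j : 'I_d => (i <= j)%N)) => //.
- by move=> a b c; exact: leq_trans.
- by move=> a b ab; apply/ord_inj/anti_leq.
- exact: directions_sorted.
by apply/allP => i _ /=; rewrite count_mem_directions ffunE.
Qed.

Lemma normc_le_add (z : R[i]) : normc z <= `|complex.Re z| + `|complex.Im z|.
Proof.
case: z => a b /=; rewrite -(@ler_pXn2r _ 2) ?nnegrE ?sqrtr_ge0 ?addr_ge0//.
rewrite sqr_sqrtr ?addr_ge0 ?sqr_ge0//.
rewrite -(real_normK (num_real a)) -(real_normK (num_real b)).
have := mulr_ge0 (normr_ge0 a) (normr_ge0 b); nra.
Qed.

Lemma norm_Re_le_normc (z : R[i]) : `|complex.Re z| <= normc z.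
Proof.
case: z => a b /=; rewrite -(@ler_pXn2r _ 2) ?nnegrE ?sqrtr_ge0//.
by rewrite sqr_sqrtr ?addr_ge0 ?sqr_ge0// real_normK ?num_real// lerDl sqr_ge0.
Qed.

Lemma norm_Im_le_normc (z : R[i]) : `|complex.Im z| <= normc z.
Proof.
case: z => a b /=; rewrite -(@ler_pXn2r _ 2) ?nnegrE ?sqrtr_ge0//.
by rewrite sqr_sqrtr ?addr_ge0 ?sqr_ge0// real_normK ?num_real// lerDr sqr_ge0.
Qed.

Lemma normc_real (a : R) : normc (a%:C)%C = `|a|.
Proof. by rewrite /= expr0n addr0 sqrtr_sqr. Qed.

Lemma monomial_le_weight alpha x : `|monomial alpha x| <= weight x ^+ (\sum_i alpha i).
Proof.
rewrite /monomial normr_prod -prodrXl; apply: ler_prod => i _; rewrite normr_ge0 /=.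
rewrite normrX; apply: le_trans (_ : (1 + `|x 0 i|) ^+ alpha i <= _).
  by rewrite lerXn2r ?nnegrE ?addr_ge0// lerDr.
apply: ler_weXn2l; first by rewrite lerDl.
by rewrite (bigD1 i)//= leq_addr.
Qed.

Lemma weighted_le_weight alpha beta f x : weighted alpha beta f x <=
  weight x ^+ (\sum_i alpha i) *
  (`|ipartial (directions beta) (fun x => complex.Re (f x)) x| +
   `|ipartial (directions beta) (fun x => complex.Im (f x)) x|).
Proof.
rewrite /weighted ComplexField.Normc.normcM normc_real; apply: ler_pM => //.
- by case: (cmderiv _ _ _) => ? ?; exact: sqrtr_ge0.
- exact: monomial_le_weight.
- exact: normc_le_add.
Qed.

(* Expanding [prod_i (1 + |x_i|^m)] bounds the weight by monomials. *)
Lemma weight_le_monomials m x : weight x ^+ m <= 2 ^+ (m * d) *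
  \sum_(b : {ffun 'I_d -> bool}) `|monomial [ffun i => if b i then m else 0%N] x|.
Proof.
have H1 (a : R) : 0 <= a -> (1 + a) ^+ m <= 2 ^+ m * (a ^+ m + 1).
  move=> a0; have [a1|/ltW a1] := leP 1 a.
    apply: (@le_trans _ _ ((2 * a) ^+ m)).
      by rewrite lerXn2r ?nnegrE ?addr_ge0 ?mulr_ge0//; lra.
    by rewrite exprMn ler_wpM2l ?exprn_ge0// lerDl.
  apply: (@le_trans _ _ (2 ^+ m)).
    by rewrite lerXn2r ?nnegrE ?addr_ge0//; lra.
  by rewrite ler_peMr ?exprn_ge0// lerDr exprn_ge0.
rewrite -prodrXl.
apply: (@le_trans _ _ (\prod_(i < d) (2 ^+ m * (`|x 0 i| ^+ m + 1)))).
  by apply: ler_prod => i _; rewrite exprn_ge0 ?addr_ge0//= H1.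
rewrite big_split /= prodr_const card_ord -exprM ler_wpM2l ?exprn_ge0//.
apply: (@le_trans _ _ (\prod_(i < d) \sum_(b : bool) (if b then `|x 0 i| ^+ m else 1))).
  by apply: ler_prod => i _; rewrite big_bool lexx addr_ge0 ?exprn_ge0.
rewrite bigA_distr_bigA /=; apply: ler_sum => b _.
rewrite /monomial normr_prod le_eqVlt; apply/orP; left; apply/eqP.
by apply: eq_bigr => i _; rewrite ffunE normrX; case: (b i).
Qed.

(** The power of the weight is dominated by finitely many monomials, each controlled by one
    seminorm. *)
Lemma weight_cmderiv_bound f m s : is_schwartz f -> nondecr s ->
  exists C : R, forall x, weight x ^+ m *
    normc (cmderiv [ffun i => count_mem i s] f x) <= C.
Proof.
move=> Sf ss; set beta := [ffun i => _].
exists (2 ^+ (m * d) * \sum_(b : {ffun 'I_d -> bool})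
    seminorm [ffun i => if b i then m else 0%N] beta f) => x.
have n0 : 0 <= normc (cmderiv beta f x).
  by case: (cmderiv _ _ _) => ? ?; exact: sqrtr_ge0.
apply: le_trans (ler_wpM2r n0 (weight_le_monomials m x)) _.
rewrite -mulrA ler_wpM2l ?exprn_ge0// mulr_suml; apply: ler_sum => b _.
have := weighted_le [ffun i => if b i then m else 0%N] beta x Sf.
by rewrite /weighted ComplexField.Normc.normcM normc_real.
Qed.

Lemma schwartz_Re_bounded_family f : is_schwartz f ->
  bounded_family (fun (_ : unit) x => complex.Re (f x)).
Proof.
move=> Sf; apply: bounded_familyP => [_|m s ss]; first exact: Sf.1.1.
have [C HC] := weight_cmderiv_bound m Sf ss; exists C => _ x.
apply: le_trans (HC x); rewrite ler_wpM2l ?(ltW (weightX_gt0 _ _))//.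
rewrite [in leLHS](sorted_directions ss).
exact: (norm_Re_le_normc (cmderiv _ f x)).
Qed.

Lemma schwartz_Im_bounded_family f : is_schwartz f ->
  bounded_family (fun (_ : unit) x => complex.Im (f x)).
Proof.
move=> Sf; apply: bounded_familyP => [_|m s ss]; first exact: Sf.1.2.
have [C HC] := weight_cmderiv_bound m Sf ss; exists C => _ x.
apply: le_trans (HC x); rewrite ler_wpM2l ?(ltW (weightX_gt0 _ _))//.
rewrite [in leLHS](sorted_directions ss).
exact: (norm_Im_le_normc (cmderiv _ f x)).
Qed.

Lemma real_is_schwartz g : bounded_family (fun _ : unit => g) ->
  is_schwartz (fun x => (g x)%:C%C : R[i]^o).
Proof.
move=> [sg bg]; split; first by split; [exact: sg tt|exact: smooth0].
move=> alpha beta.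
have [C HC] := bg (\sum_i alpha i)%N (size (directions beta)).
exists C => _ [x _ <-]; apply: le_trans (weighted_le_weight _ _ _ _) _.
rewrite /= ipartial0 normr0 addr0.
exact: (HC tt _ x (directions_sorted beta)).
Qed.

End schwartz_transfer.

(** * Totality of the moment functions and uniqueness of the distribution *)

Section totality.
Context {R : realType} {d : nat}.
Local Notation E := 'rV[R]_d.
Local Notation normc := ComplexField.Normc.normc.

Lemma schwartz_sumE (I : Type) (r : seq I) (F : I -> schwartz R d) (x : E) :
  (\sum_(i <- r) F i) x = \sum_(i <- r) F i x :> R[i].
Proof. by elim: r => [|i r IH]; rewrite ?big_nil// !big_cons -IH. Qed.

Lemma sum_complex (I : Type) (r : seq I) (F G : I -> R) :
  \sum_(i <- r) (F i +i* G i)%C = ((\sum_(i <- r) F i) +i* (\sum_(i <- r) G i))%C.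
Proof. by elim: r => [|i r IH]; rewrite ?big_nil// !big_cons IH. Qed.

Lemma linear_span_seq (K : numFieldType) (V : tvsType K) (I : Type) (u : I -> V)
    (l : seq (K * I)) :
  linear_span (range u) (\sum_(a <- l) a.1 *: u a.2).
Proof.
exists (size l), (fun i => (tnth (in_tuple l) i).1),
  (fun i => u (tnth (in_tuple l) i).2).
by split=> [i|]; [exists (tnth (in_tuple l) i).2|rewrite big_tnth].
Qed.

(** Once the values agree, only proofs of linearity and continuity remain to be compared, and proof
    irrelevance identifies them. *)
Lemma tempered_ext (T1 T2 : tempered R d) : (forall f, T1 f = T2 f) -> T1 = T2.
Proof.
case: T1 T2 => [[f1 c1] H1] [[f2 c2] H2] /= E12.
have Ef : f1 = f2 by apply/funext.
case: _ / Ef c2 H2 E12 => c2 H2 _.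
have Ec : c1 = c2.
  by case: c1 c2 H1 H2 => [[a1] [b1]] [[a2] [b2]] _ _;
    congr (GRing.Linear.Class _ _); congr (_ _); exact: Prop_irrelevance.
case: _ / Ec H2 => H2; congr Tempered; exact: Prop_irrelevance.
Qed.

(** The set where the continuous functional T1 - T2 is nonzero is open. Were it nonempty, it would
    meet the dense span of [X], on which T1 - T2 vanishes by linearity. *)
Lemma tempered_eq_of_total (X : set (schwartz R d)) (T1 T2 : tempered R d) :
  total_set X -> (forall f, X f -> T1 f = T2 f) -> T1 = T2.
Proof.
move=> totX T12; apply: tempered_ext => f; apply: contrapT => /eqP ne.
have cT : continuous (fun g : schwartz R d => T1 g - T2 g : R[i]^o).
  by move=> g; exact: (continuousB (@temperedP _ _ T1 g) (@temperedP _ _ T2 g)).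
pose O := (fun g : schwartz R d => T1 g - T2 g : R[i]^o) @^-1` [set z | z != 0].
have oO : open O.
  apply: open_comp => [g _|]; first exact: cT.
  rewrite (_ : [set z | z != 0] = ~` [set 0]); last first.
    by apply/seteqP; split=> z /= /eqP.
  apply: closed_openC; apply: accessible_closed_set1.
  by apply: hausdorff_accessible; exact: norm_hausdorff.
have [] := totX O _ oO; first by exists f; rewrite /O /= subr_eq0.
move=> g [Og [n [a [u [Xu gE]]]]].
have T12g : T1 g = T2 g.
  rewrite gE !linear_sum; apply: eq_bigr => i _.
  by rewrite !linearZ /= T12.
by move: Og; rewrite /O /= T12g subrr eqxx.
Qed.

Section moments.
Variables (A : 'M[R]_d) (c : R).
Hypotheses (d_gt0 : (0 < d)%N) (A_posdef : posdef A) (c_gt0 : 0 < c).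

Lemma monomial_polyfun (alpha : multiindex d) : polyfun (@monomial R d alpha).
Proof.
rewrite /monomial; elim: (index_enum _) => [|i s IH].
  by under eq_fun do rewrite big_nil; exact: polyfun_cst.
under eq_fun do rewrite big_cons; apply: polyfunM => //.
by apply: polyfunX; exact: polyfun_coord.
Qed.

Lemma moment_is_schwartz (alpha : multiindex d) :
  (fun x => ((monomial alpha x * gaussian A c x)%:C)%C : R[i]^o) \in
    @schwartz_pred R d.
Proof.
apply/mem_set; apply: real_is_schwartz.
exact: gaussian_polys_bounded_family (monomial_polyfun alpha).
Qed.

Definition moment alpha : schwartz R d := Schwartz (moment_is_schwartz alpha).

(** Real and imaginary parts are approximated separately by p phi and q phi; expanding p + i q into
    monomials gives an element of the complex span. *)
Lemma moment_total : total_set (range moment).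
Proof.
move=> O [f Of] oO.
have [L [e [e0 LO]]] : nbhs f O by exact: open_nbhs_nbhs.
have Sf : is_schwartz f by exact: set_mem (schwartz_funP f).
(* [m] and [N] dominate the orders of all index pairs in the finite list [L], so one approximation
   serves every seminorm of the neighbourhood. *)
pose m := (\sum_(ab <- L) \sum_i ab.1 i)%N.
pose N := (\sum_(ab <- L) size (directions ab.2))%N.
have e40 : 0 < e / 4 by rewrite divr_gt0.
have [_ [[p Hp ->] sp Rp]] := (approximable_gaussian_polys d_gt0 A_posdef c_gt0
  (schwartz_Re_bounded_family Sf)).2 m N _ e40.
have [_ [[q Hq ->] sq Iq]] := (approximable_gaussian_polys d_gt0 A_posdef c_gt0
  (schwartz_Im_bounded_family Sf)).2 m N _ e40.
have [[k pE] [l qE]] := (polyfun_monomials Hp, polyfun_monomials Hq).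
pose r : seq (R[i] * multiindex d) :=
  [seq ((a.1)%:C%C, a.2) | a <- k] ++ [seq ((0 +i* a.1)%C, a.2) | a <- l].
exists (\sum_(a <- r) a.1 *: moment a.2); split; last exact: linear_span_seq.
set g := (\sum_(a <- r) a.1 *: moment a.2 : schwartz R d).
have gE x : g x = ((p x * gaussian A c x) +i* (q x * gaussian A c x))%C.
  rewrite /g schwartz_sumE /r big_cat !big_map /= pE qE !mulr_suml.
  rewrite (eq_bigr (fun a => (a.1 * monomial a.2 x * gaussian A c x +i* 0)%C)).
    rewrite [X in _ + X](eq_bigr (fun a =>
      (0 +i* (a.1 * monomial a.2 x * gaussian A c x))%C)).
      by rewrite !sum_complex !big1_eq; apply/eqP; rewrite eq_complex /= addr0 add0r !eqxx.
    move=> a _; rewrite -[LHS]/(_ * _); apply/eqP; rewrite eq_complex /=.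
    by rewrite !mul0r !mulr0 subrr add0r mulrA !eqxx.
  move=> a _; rewrite -[LHS]/(_ * _); apply/eqP; rewrite eq_complex /=.
  by rewrite !mul0r !mulr0 subr0 addr0 mulrA !eqxx.
apply: LO => -[alpha beta] abL.
have ma : (\sum_i alpha i <= m)%N by rewrite /m (big_rem _ abL) leq_addr.
have Nb : (size (directions beta) <= N)%N by rewrite /N (big_rem _ abL) leq_addr.
(* The supremum only yields a weak inequality, so the two errors are kept to e / 2 in total to stay
   strictly inside the ball. *)
apply: (@le_lt_trans _ _ (e / 4 + e / 4)); last by lra.
apply: ge_sup; first by exists (weighted alpha beta (g - f : schwartz R d) 0), 0.
move=> _ [x _ <-]; apply: le_trans (weighted_le_weight _ _ _ _) _.
have vE y : (g - f : schwartz R d) y = g y - f y :> R[i] by [].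
have ReE : (fun y => complex.Re ((g - f : schwartz R d) y)) =
    fun y => p y * gaussian A c y - complex.Re (f y).
  by apply/funext => y; rewrite vE gE; case: (f y).
have ImE : (fun y => complex.Im ((g - f : schwartz R d) y)) =
    fun y => q y * gaussian A c y - complex.Im (f y).
  by apply/funext => y; rewrite vE gE; case: (f y).
have [sRe sIm] : csmooth f := Sf.1.
rewrite ReE ImE !ipartialB//.
have H1 := Rp _ x (directions_sorted beta) Nb.
have H2 := Iq _ x (directions_sorted beta) Nb.
rewrite !ipartialB// in H1 H2.
apply: (@le_trans _ _ (weight x ^+ m * (`|ipartial (directions beta)
    (fun y => p y * gaussian A c y) x - ipartial (directions beta)
    (fun y => complex.Re (f y)) x| + `|ipartial (directions beta)
    (fun y => q y * gaussian A c y) x - ipartial (directions beta)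
    (fun y => complex.Im (f y)) x|))).
  by rewrite ler_wpM2r ?addr_ge0// weightX_le.
by rewrite mulrDr lerD// distrC.
Qed.

End moments.

End totality.

Theorem theorem7p2 (R : realType) (d : nat) (A : 'M[R]_d) (c : R)
    (d_gt0 : (0 < d)%N) (A_sym : A^T = A) (A_posdef : posdef A) (c_gt0 : 0 < c) :
  exists moment_fun : multiindex d -> schwartz R d,
    [/\ forall (alpha : multiindex d) (x : 'rV[R]_d),
          moment_fun alpha x = ((monomial alpha x * gaussian A c x)%:C)%C,
        total_set (range moment_fun)
      & forall T1 T2 : tempered R d,
          (forall alpha, T1 (moment_fun alpha) = T2 (moment_fun alpha)) ->
          T1 = T2].
Proof.
have tot := moment_total d_gt0 A_posdef c_gt0.
exists (moment c d_gt0 A_posdef); split=> // T1 T2 T12.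
by apply: tempered_eq_of_total tot _ => _ [alpha _ <-].
Qed.
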